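(* Let $M(\phi,\xi,\eta,g_M)$ be a cosymplectic manifold, $(N,g_N)$ a Riemannian manifold, and $F:M\to N$ a proper slant Riemannian submersion with slant angle $\theta$ such that $\xi$ is horizontal. Then $F$ is a totally geodesic map if and only if $$g_M(\mathcal H\nabla_U\omega\psi V,X)=g_M(\mathcal T_U\omega V,\mathcal BX)+g_M(\mathcal H\nabla_U\omega V,\mathcal CX)$$ and $$g_M(\mathcal H\nabla_Y\omega\psi U,X)=g_M(\mathcal A_Y\omega U,\mathcal BX)+g_M(\mathcal H\nabla_Y\omega U,\mathcal CX)$$ for all $U,V\in\Gamma(\ker F_* )$ and $X,Y\in\Gamma((\ker F_* )^\perp)$.
   Context: An almost contact metric structure $(\phi,\xi,\eta,g_M)$ on an odd-dimensional manifold $M$ consists of a $(1,1)$-tensor $\phi$, a vector field $\xi$, a $1$-form $\eta$ and a Riemannian metric $g_M$ with $\phi^2=-I+\eta\otimes\xi$, $\phi\xi=0$, $\eta\circ\phi=0$, $\eta(\xi)=1$, $g_M(\phi X,\phi Y)=g_M(X,Y)-\eta(X)\eta(Y)$, $\eta(X)=g_M(X,\xi)$. It is cosymplectic if it is normal and $\eta$ and $\Phi(X,Y)=g_M(X,\phi Y)$ are closed; the structure equation is $\nabla\phi=0$, and then $\nabla\xi=0$ ($\nabla$ the Levi-Civita connection of $g_M$). A Riemannian submersion $F:(M,g_M)\to(N,g_N)$ is a smooth surjective map of maximal rank such that $F_*$ preserves the lengths of horizontal vectors. Vertical means in $\ker F_*$, horizontal means in $(\ker F_* )^\perp$; $\mathcal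 V,\mathcal H$ are the corresponding orthogonal projections. O'Neill's tensors are $\mathcal T_EG=\mathcal H\nabla_{\mathcal VE}\mathcal VG+\mathcal V\nabla_{\mathcal VE}\mathcal HG$ and $\mathcal A_EG=\mathcal V\nabla_{\mathcal HE}\mathcal HG+\mathcal H\nabla_{\mathcal HE}\mathcal VG$. For vertical $U$: $\phi U=\psi U+\omega U$ with $\psi U$ vertical, $\omega U$ horizontal. For horizontal $X$: $\phi X=\mathcal BX+\mathcal CX$ with $\mathcal BX$ vertical, $\mathcal CX$ horizontal. $F$ (with $\xi$ horizontal) is slant if for every nonzero vertical vector $X$ the angle between $\phi X$ and $\ker F_*$ is a constant $\theta$ (the slant angle) independent of the point and of $X$; it is proper if $\theta\ne0$ and $\theta\ne\pi/2$. $F$ is totally geodesic if its second fundamental form $(\nabla F_* )(X,Y)=\nabla^F_XF_*Y-F_*(\nabla_XY)$ vanishes for all $X,Y\in\Gamma(TM)$, where $\nabla^F$ is the pullback connection. *)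

(* Defs.v *)
From HB Require Import structures.
From mathcomp Require Import all_boot all_order all_algebra.
From mathcomp Require Import boolp classical_sets functions reals.
From mathcomp Require Import interval_inference topology.
From mathcomp Require Import normedtype landau derive trigo.
From mathcomp Require Import ring.
Set Implicit Arguments.
Unset Strict Implicit.
Unset Printing Implicit Defensive.
Import Order.TTheory GRing.Theory Num.Theory.
Import numFieldNormedType.Exports.
Local Open Scope classical_set_scope.
Local Open Scope ring_scope.

Section Calculus.
Context {R : realType}.

Fixpoint Ck (n k : nat) (U : set 'rV[R]_n) (f : 'rV[R]_n -> R) : Prop :=
  if k is k'.+1 then
    (forall x, U x -> differentiable f x) /\
    (forall i : 'I_n, Ck k' U (fun x => 'D_(delta_mx 0 i) f x))
  else forall x, U x -> {for x, continuous f}.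

(* U is meant to be open; f is only constrained on U. *)
Definition smooth_on (n : nat) (U : set 'rV[R]_n) (f : 'rV[R]_n -> R) : Prop :=
  forall k, Ck k U f.

Lemma Ck_local n k (U : set 'rV[R]_n) f :
  (forall x, U x -> exists2 V, V x & Ck k V f) -> Ck k U f.
Proof.
elim: k f => [|k IH] f /= H.
  by move=> x /H[V Vx]; apply.
split=> [x /H[V Vx [+ _]]|i]; first exact.
by apply: IH => x /H[V Vx [_ HV]]; exists V.
Qed.

Lemma near_differentiable n (f g : 'rV[R]_n -> R) x :
  (\forall y \near x, f y = g y) -> differentiable f x -> differentiable g x.
Proof.
move=> fg df.
have h0 : \forall y \near x, (g - f) y = 0.
  by apply: filterS fg => y fgy; rewrite !fctE fgy subrr.
suff dh : differentiable (g - f) x.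
  by rewrite -(subrK f g); apply: differentiableD.
have hx : (g - f) x = 0 by exact: nbhs_singleton h0.
pose z : {linear 'rV[R]_n -> R} := \0.
have E : (g - f) \o shift x = cst ((g - f) x) + z +o_ 0 id.
  apply/eqaddoP => _/posnumP[e].
  have : \forall y \near (0 : 'rV[R]_n), (g - f) (y + x) = 0.
    by move: h0; rewrite (near_shift 0) /=; apply: filterS => y; rewrite subr0.
  apply: filterS => y hy; rewrite !fctE /=.
  move: hy; rewrite !fctE => ->; move: hx; rewrite !fctE => ->.
  by rewrite /z/= addr0 subrr normr0 mulr_ge0.
have cz : continuous z by move=> y; exact: cst_continuous.
by apply/diff_locallyP; rewrite (diff_unique cz E).
Qed.

Lemma Ck_eq n k (U : set 'rV[R]_n) f g : open U ->
  (forall x, U x -> f x = g x) -> Ck k U f -> Ck k U g.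
Proof.
move=> oU; elim: k f g => [|k IH] f g fg /=.
  move=> H x Ux; have := H x Ux.
  rewrite /prop_for /continuous_at -(fg x Ux); apply: cvg_trans.
  apply: (@near_eq_cvg _ _ (nbhs x)).
  by apply: filterS (open_nbhs_nbhs (conj oU Ux)) => y /fg.
have nfg x : U x -> \forall y \near x, f y = g y.
  by move=> Ux; apply: filterS (open_nbhs_nbhs (conj oU Ux)) => y /fg.
move=> [df H]; split=> [x Ux|i];
  first exact: near_differentiable (nfg x Ux) (df x Ux).
by apply: IH (H i) => x Ux; apply: near_eq_derive; exact: nfg.
Qed.

Lemma CkW n k (U : set 'rV[R]_n) f : Ck k.+1 U f -> Ck k U f.
Proof.
elim: k f => [|k IH] f [df H].
  by move=> x Ux; apply: differentiable_continuous; exact: df.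
by split=> // i; apply: IH; exact: H.
Qed.

Lemma Ck_cst n k (U : set 'rV[R]_n) (a : R) : Ck k U (cst a).
Proof.
elim: k a => [|k IH] a; first by move=> x _; exact: cst_continuous.
split=> [x _|i]; first exact: differentiable_cst.
rewrite (_ : (fun x => _) = cst 0); first exact: IH.
by apply/funext => x; rewrite derive_cst.
Qed.

Lemma CkD n k (U : set 'rV[R]_n) f g : open U ->
  Ck k U f -> Ck k U g -> Ck k U (f + g).
Proof.
move=> oU; elim: k f g => [|k IH] f g.
  by move=> Hf Hg x Ux; apply: continuousD; [exact: Hf|exact: Hg].
move=> [df Hf] [dg Hg]; split=> [x Ux|i].
  by apply: differentiableD; [exact: df|exact: dg].
apply: Ck_eq (IH _ _ (Hf i) (Hg i)) => // x Ux.
by rewrite deriveD//; apply: diff_derivable; [exact: df|exact: dg].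
Qed.

Lemma CkM n k (U : set 'rV[R]_n) f g : open U ->
  Ck k U f -> Ck k U g -> Ck k U (f * g).
Proof.
move=> oU; elim: k f g => [|k IH] f g.
  by move=> Hf Hg x Ux; apply: continuousM; [exact: Hf|exact: Hg].
move=> Hf' Hg'; have [df Hf] := Hf'; have [dg Hg] := Hg'; split=> [x Ux|i].
  by apply: differentiableM; [exact: df|exact: dg].
have H := CkD oU (IH _ _ (CkW Hf') (Hg i)) (IH _ _ (CkW Hg') (Hf i)).
apply: Ck_eq H => // x Ux.
by rewrite deriveM//; apply: diff_derivable; [exact: df|exact: dg].
Qed.

Lemma Ck_sum n k (U : set 'rV[R]_n) m (f : 'I_m -> 'rV[R]_n -> R) : open U ->
  (forall i, Ck k U (f i)) -> Ck k U (\sum_i f i).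
Proof.
move=> oU Hf; elim/big_ind : _ => //; first exact: Ck_cst.
by move=> ? ?; exact: CkD.
Qed.

Lemma Ck_comp m n k (U : set 'rV[R]_m) (V : set 'rV[R]_n)
    (G : 'rV[R]_m -> 'rV[R]_n) f : open U -> (forall x, U x -> V (G x)) ->
  (forall j, smooth_on U (fun x => G x 0 j)) -> Ck k V f -> Ck k U (f \o G).
Proof.
move=> oU UV HG.
have dGj j x : U x -> differentiable (fun x => G x 0 j) x.
  by move=> Ux; exact: (HG j 1%N).1.
have GE : G = \sum_j (fun x => G x 0 j *: delta_mx 0 j).
  by apply/funext => x; rewrite fct_sumE [LHS]row_sum_delta.
have dG x : U x -> differentiable G x.
  move=> Ux; rewrite GE; apply: differentiable_sum => j.
  by apply: differentiableZl; exact: dGj.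
have dGE x i : U x -> 'D_(delta_mx 0 i) G x =
    \sum_j 'D_(delta_mx 0 i) (fun x => G x 0 j) x *: delta_mx 0 j.
  move=> Ux; rewrite {1}GE derive_sum.
    apply: eq_bigr => j _.
    rewrite deriveE; last by apply: differentiableZl; exact: dGj.
    by rewrite diffZl ?deriveE//; exact: dGj.
  by move=> j; apply: diff_derivable; apply: differentiableZl; exact: dGj.
elim: k f => [|k IH] f /=.
  move=> Hf x Ux; apply: continuous_comp; last exact: Hf (UV _ Ux).
  by apply: differentiable_continuous; exact: dG.
move=> [df Hf]; split=> [x Ux|i].
  by apply: differentiable_comp; [exact: dG|exact: df (UV _ Ux)].
pose g j : 'rV[R]_m -> R := (fun x => 'D_(delta_mx 0 i) (fun x => G x 0 j) x) *
   ((fun y => 'D_(delta_mx 0 j) f y) \o G).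
have Hg j : Ck k U (g j).
  by apply: CkM => //; [exact: (HG j k.+1).2 i|exact: IH (Hf j)].
apply: Ck_eq (Ck_sum oU Hg) => //.
move=> x Ux; have dfx := df _ (UV _ Ux).
rewrite deriveE; last by apply: differentiable_comp; [exact: dG|].
rewrite diff_comp//; last exact: dG.
rewrite /= -[X in 'd f _ X]deriveE; last exact: dG.
rewrite dGE// linear_sum fct_sumE; apply: eq_bigr => j _.
by rewrite linearZ/= -deriveE.
Qed.

End Calculus.

Section Manifolds.
Context {R : realType}.

(* chart_fun and chart_inv are total functions whose values outside chart_dom
   and its image are irrelevant. *)
Record chart (n : nat) (T : topologicalType) := Chart {
  chart_dom : set T;
  chart_fun :> T -> 'rV[R]_n;
  chart_inv : 'rV[R]_n -> T;
  chart_dom_open : open chart_dom;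
  chart_img_open : open (chart_fun @` chart_dom);
  chart_funK : forall p, chart_dom p -> chart_inv (chart_fun p) = p;
  chart_fun_continuous :
    forall p, chart_dom p -> {for p, continuous chart_fun};
  chart_inv_continuous :
    forall x, (chart_fun @` chart_dom) x -> {for x, continuous chart_inv} }.

Arguments chart_img_open {n T} c.

(* The atlas need not be maximal: an atlas and the maximal atlas containing it
   have the same smooth functions and the same smooth maps. *)
Record manifold (n : nat) := Manifold {
  manifold_space :> topologicalType;
  atlas : set (chart n manifold_space);
  manifold_hausdorff : hausdorff_space manifold_space;
  manifold_second_countable : @second_countable manifold_space;
  atlas_cover : forall p, exists2 c, atlas c & chart_dom c p;
  atlas_compatible : forall c d, atlas c -> atlas d -> forall j,
    smooth_on (c @` (chart_dom c `&` chart_dom d))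
              (fun x => d (chart_inv c x) 0 j) }.

Definition smooth_fun n (M : manifold n) (f : M -> R) : Prop :=
  forall c, atlas c ->
    smooth_on (c @` chart_dom c) (fun x => f (chart_inv c x)).

Record smooth_map m n (M : manifold m) (N : manifold n) := SmoothMap {
  smooth_map_fun :> M -> N;
  smooth_map_continuous : continuous smooth_map_fun;
  smooth_map_smooth : forall c d, atlas c -> atlas d -> forall j,
    smooth_on (c @` (chart_dom c `&` smooth_map_fun @^-1` chart_dom d))
              (fun x => d (smooth_map_fun (chart_inv c x)) 0 j) }.

Lemma chart_open_image n (T : topologicalType) (c : chart n T) (A : set T) :
  open A -> open (c @` (chart_dom c `&` A)).
Proof.
move=> oA; rewrite openE => _ [p [cp Ap] <-].
have ci : (c @` chart_dom c) (c p) by exists p.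
have nA : \forall x \near c p, A (chart_inv c x).
  apply: (chart_inv_continuous ci); rewrite chart_funK//.
  exact: open_nbhs_nbhs.
have nI : nbhs (c p) (c @` chart_dom c).
  by apply: open_nbhs_nbhs; split => //; exact: chart_img_open.
rewrite /interior; apply: filterS2 nI nA => _ [q cq <-].
by rewrite chart_funK// => Aq; exists q.
Qed.

Lemma smooth_comp m n (M : manifold m) (N : manifold n) (F : smooth_map M N)
  (f : N -> R) : smooth_fun f -> smooth_fun (f \o F).
Proof.
move=> sf c Mc k; apply: Ck_local => _ [p cp <-].
have [d Nd dFp] := atlas_cover (F p).
pose U := c @` (chart_dom c `&` F @^-1` chart_dom d).
have oU : open U.
  apply: chart_open_image; apply: open_comp; last exact: chart_dom_open.
  by move=> x _; exact: smooth_map_continuous.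
exists U; first by exists p.
pose G x := d (F (chart_inv c x)).
have GV x : U x -> (d @` chart_dom d) (G x).
  by move=> [q [cq dq] <-]; rewrite /G chart_funK//; exists (F q).
apply: Ck_eq (Ck_comp oU GV (smooth_map_smooth F Mc Nd) (sf d Nd k)) => //.
by move=> _ [q [cq dq] <-]; rewrite /= /G chart_funK// chart_funK.
Qed.

Definition smooth_pred n (M : manifold n) : {pred M -> R} :=
  fun f => `[< smooth_fun f >].

Section SmoothFunctions.
Variables (n : nat) (M : manifold n).

Let smooth_subring : subring_closed (@smooth_pred n M).
Proof.
have oI (c : chart n M) := chart_img_open c.
have sc a : smooth_fun (cst a : M -> R) by move=> c _ k; exact: Ck_cst.
have sM f g : smooth_fun f -> smooth_fun g -> smooth_fun (f * g : M -> R).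
  by move=> sf sg c Mc k; apply: CkM; [exact: oI|exact: sf|exact: sg].
split=> [|f g /asboolP sf /asboolP sg|f g /asboolP sf /asboolP sg].
- by apply/asboolP; exact: sc.
- apply/asboolP => c Mc k; apply: CkD; [exact: oI|exact: sf|].
  have := sM _ _ (sc (-1)) sg c Mc k; congr Ck; apply/funext => x.
  by rewrite !fctE mulN1r.
- by apply/asboolP; exact: sM.
Qed.

Let smooth_scale : scaler_closed (@smooth_pred n M).
Proof.
move=> a f /asboolP sf; apply/asboolP => c Mc k.
by apply: (CkM (chart_img_open c) (Ck_cst _ _ a)); exact: sf.
Qed.

HB.instance Definition _ :=
  GRing.isSubringClosed.Build (M -> R) (@smooth_pred n M) smooth_subring.
HB.instance Definition _ :=
  GRing.isScaleClosed.Build R (M -> R) (@smooth_pred n M) smooth_scale.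

Record Cinf := SmoothFun {
  Cinf_fun :> M -> R ; _ : Cinf_fun \in @smooth_pred n M }.
HB.instance Definition _ := [isSub for Cinf_fun].
HB.instance Definition _ := [Choice of Cinf by <:].
HB.instance Definition _ :=
  GRing.SubChoice_isSubComPzRing.Build (M -> R) _ Cinf smooth_subring.
HB.instance Definition _ := [SubZmodule_isSubLmodule of Cinf by <:].

End SmoothFunctions.
End Manifolds.

Arguments manifold R n : clear implicits.

Section Tangent.
Context {R : realType}.

(* Tangent vectors at p are derivations at p of the algebra of smooth
   functions. *)
Section TangentSpace.
Variables (n : nat) (M : manifold R n) (p : M).

Definition derivation_at : {pred Cinf M -> R^o} := fun v => `[<
  (forall a f g, v (a *: f + g) = a * v f + v g) /\
  (forall f g, v (f * g) = f p * v g + g p * v f) >].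

Let derivation_at_submod : submod_closed derivation_at.
Proof.
split=> [|a u v /asboolP[lu du] /asboolP[lv dv]]; apply/asboolP.
  have E f : (0 : Cinf M -> R^o) f = 0 by [].
  by split=> *; rewrite !E !mulr0 addr0.
have E f : (a *: u + v) f = a * u f + v f by [].
by split=> [b f g|f g]; rewrite !E; [rewrite lu lv|rewrite du dv]; ring.
Qed.

HB.instance Definition _ :=
  GRing.isSubmodClosed.Build R (Cinf M -> R^o) derivation_at
    derivation_at_submod.

Record tangent := Tangent {
  tangent_fun :> Cinf M -> R^o ; _ : tangent_fun \in derivation_at }.
HB.instance Definition _ := [isSub for tangent_fun].
HB.instance Definition _ := [Choice of tangent by <:].
HB.instance Definition _ := [SubChoice_isSubLmodule of tangent by <:].

Lemma tangent_linear (v : tangent) a f g : v (a *: f + g) = a * v f + v g.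
Proof. by case: v => v /= /asboolP[+ _]; exact. Qed.

Lemma tangent_leibniz (v : tangent) f g : v (f * g) = f p * v g + g p * v f.
Proof. by case: v => v /= /asboolP[_]; exact. Qed.

End TangentSpace.
End Tangent.

Section Derivations.
Context {R : realType}.
Variables (m n : nat) (M : manifold R m) (N : manifold R n).
Variable h : Cinf N -> Cinf M.

Definition derivation_over : {pred Cinf N -> (Cinf M)^o} := fun W => `[<
  (forall (a : R) f g, W (a *: f + g) = a *: (W f : Cinf M) + W g) /\
  (forall f g, W (f * g) = h f * W g + h g * W f) >].

Let derivation_over_submod : submod_closed derivation_over.
Proof.
split=> [|a u v /asboolP[lu du] /asboolP[lv dv]]; apply/asboolP.
  have E f : (0 : Cinf N -> (Cinf M)^o) f = 0 by [].
  by split=> *; rewrite !E ?scaler0 ?mulr0 addr0.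
have E f : (a *: u + v) f = a * u f + v f by [].
split=> [b f g|f g]; rewrite !E; [rewrite lu lv|rewrite du dv]; last by ring.
apply: val_inj; apply/funext => p.
rewrite /= !fctE /= /GRing.scale/=; ring.
Qed.

HB.instance Definition _ :=
  GRing.isSubmodClosed.Build (Cinf M) (Cinf N -> (Cinf M)^o) derivation_over
    derivation_over_submod.

Record derivation := Derivation {
  derivation_fun :> Cinf N -> (Cinf M)^o ;
  _ : derivation_fun \in derivation_over }.
HB.instance Definition _ := [isSub for derivation_fun].
HB.instance Definition _ := [Choice of derivation by <:].
HB.instance Definition _ := [SubChoice_isSubLmodule of derivation by <:].

Lemma deriv_linear (W : derivation) (a : R) f g :
  W (a *: f + g) = a *: (W f : Cinf M) + W g.
Proof. by case: W => W /= /asboolP[+ _]; exact. Qed.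

Lemma deriv_leibniz (W : derivation) f g : W (f * g) = h f * W g + h g * W f.
Proof. by case: W => W /= /asboolP[_]; exact. Qed.

End Derivations.

(* Smooth vector fields on M are derivations of the algebra Cinf M, and smooth
   sections of the pullback bundle F^* TN are derivations Cinf N -> Cinf M over
   the pullback of functions. Because tangent vectors are derivations at a
   point, the passage between such a derivation W and the section
   p |-> (f |-> W f p) is mere currying (see field_at and along_at). *)
Definition vfield (R : realType) n (M : manifold R n) :=
  derivation (@id (Cinf M)).

HB.instance Definition _ (R : realType) n (M : manifold R n) :=
  GRing.Lmodule.on (vfield M).

Section Fields.
Context {R : realType}.
Variables (n : nat) (M : manifold R n).

Definition mkCinf (f : M -> R) (sf : smooth_fun f) : Cinf M :=
  SmoothFun (asboolT sf : f \in @smooth_pred R n M).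

Lemma Cinf_smooth (f : Cinf M) : smooth_fun f.
Proof. by case: f => f /= /asboolP. Qed.
End Fields.

Section Pullback.
Context {R : realType}.
Variables (m n : nat) (M : manifold R m) (N : manifold R n).
Variable F : smooth_map M N.

Definition pull (f : Cinf N) : Cinf M :=
  mkCinf (smooth_comp F (Cinf_smooth f)).

Lemma pull_linear a f g : pull (a *: f + g) = a *: pull f + pull g.
Proof. exact: val_inj. Qed.

Lemma pullM f g : pull (f * g) = pull f * pull g.
Proof. exact: val_inj. Qed.

Definition along := derivation pull.
HB.instance Definition _ := GRing.Lmodule.on along.

Let differential_proof p (v : tangent p) :
  v \o pull \in @derivation_at R n N (F p).
Proof.
apply/asboolP; split=> [a f g|f g] /=.
  by rewrite pull_linear tangent_linear.
by rewrite pullM tangent_leibniz.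
Qed.

Definition differential p (v : tangent p) : tangent (F p) :=
  Tangent (differential_proof v).

Let push_proof (X : vfield M) : (X \o pull) \in derivation_over pull.
Proof.
apply/asboolP; split=> [a f g|f g] /=.
  by rewrite pull_linear deriv_linear.
by rewrite pullM deriv_leibniz.
Qed.

Definition push (X : vfield M) : along := Derivation (push_proof X).

Let comp_along_proof (Z : vfield N) : (pull \o Z) \in derivation_over pull.
Proof.
apply/asboolP; split=> [a f g|f g] /=.
  by rewrite deriv_linear pull_linear.
by rewrite deriv_leibniz; apply: val_inj.
Qed.

Definition comp_along (Z : vfield N) : along := Derivation (comp_along_proof Z).

Let along_at_proof (W : along) p :
  (fun f => (W f : Cinf M) p) \in @derivation_at R n N (F p).
Proof.
apply/asboolP; split=> [a f g|f g] /=; first by rewrite deriv_linear.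
by rewrite deriv_leibniz.
Qed.

Definition along_at (W : along) p : tangent (F p) :=
  Tangent (along_at_proof W p).

End Pullback.

Section VectorFields.
Context {R : realType}.
Variables (n : nat) (M : manifold R n).

Let field_at_proof (X : vfield M) p :
  (fun f => (X f : Cinf M) p) \in @derivation_at R n M p.
Proof.
apply/asboolP; split=> [a f g|f g] /=; first by rewrite deriv_linear.
by rewrite deriv_leibniz.
Qed.

Definition field_at (X : vfield M) p : tangent p :=
  Tangent (field_at_proof X p).

Let bracket_proof (X Y : vfield M) :
  (fun f => X (Y f) - Y (X f)) \in derivation_over (@id (Cinf M)).
Proof.
apply/asboolP; split=> [a f g|f g] /=.
  by rewrite !deriv_linear; apply: val_inj; apply/funext => p;
     rewrite /= !fctE /= /GRing.scale/=; ring.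
have D (Z : vfield M) u v : Z (u + v) = Z u + Z v.
  by have := deriv_linear Z 1 u v; rewrite !scale1r.
rewrite !(deriv_leibniz, D) /=; ring.
Qed.

Definition bracket (X Y : vfield M) : vfield M :=
  Derivation (bracket_proof X Y).

End VectorFields.

Section Tensors.
Context {R : realType}.
Variables (n : nat) (M : manifold R n).

Record metric := Metric {
  metric_fun :> forall p : M, tangent p -> tangent p -> R;
  metric_sym : forall p u v, @metric_fun p u v = @metric_fun p v u;
  metric_linear : forall p a u v w,
    @metric_fun p (a *: u + v) w = a * @metric_fun p u w + @metric_fun p v w;
  metric_pos : forall p v, v != 0 -> 0 < @metric_fun p v v;
  metric_smooth : forall X Y : vfield M,
    smooth_fun (fun p => @metric_fun p (field_at X p) (field_at Y p)) }.

Record tensor11 := Tensor11 {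
  tensor_fun :> forall p : M, {linear tangent p -> tangent p};
  tensor_smooth : forall (X : vfield M) (f : Cinf M),
    smooth_fun (fun p => tensor_fun p (field_at X p) f) }.

Record oneform := OneForm {
  oneform_fun :> forall p : M, {linear tangent p -> R^o};
  oneform_smooth : forall X : vfield M,
    smooth_fun (fun p => oneform_fun p (field_at X p)) }.

Definition inner (g : metric) (X Y : vfield M) : Cinf M :=
  mkCinf (metric_smooth g X Y).

Definition eval1 (eta : oneform) (X : vfield M) : Cinf M :=
  mkCinf (oneform_smooth eta X).

Let tapp_proof (t : tensor11) (X : vfield M) :
  (fun f => mkCinf (tensor_smooth t X f)) \in derivation_over (@id (Cinf M)).
Proof.
apply/asboolP; split=> [a f g|f g]; apply: val_inj; apply/funext => p /=.
  by rewrite tangent_linear.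
by rewrite tangent_leibniz.
Qed.

Definition tapp (t : tensor11) (X : vfield M) : vfield M :=
  Derivation (tapp_proof t X).

End Tensors.

Section Connections.
Context {R : realType}.
Variables (m n : nat) (M : manifold R m) (N : manifold R n).

(* Covariant derivatives on TM (h = id) and on F^* TN (h = pull F). *)
Definition is_connection (h : Cinf N -> Cinf M)
    (nabla : vfield M -> derivation h -> derivation h) : Prop :=
  [/\ forall (f : Cinf M) X Y W,
        nabla (f *: X + Y) W = f *: nabla X W + nabla Y W,
      forall X W W', nabla X (W + W') = nabla X W + nabla X W'
    & forall X (f : Cinf M) W,
        nabla X (f *: W) = (X f : Cinf M) *: W + f *: nabla X W].

End Connections.

Definition levi_civita (R : realType) n (M : manifold R n) (g : metric M)
    (nabla : vfield M -> vfield M -> vfield M) : Prop :=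
  [/\ is_connection nabla,
      forall X Y, nabla X Y - nabla Y X = bracket X Y
    & forall X Y Z : vfield M,
        X (inner g Y Z) = inner g (nabla X Y) Z + inner g Y (nabla X Z)].

Section AlmostContact.
Context {R : realType}.
Variables (n : nat) (M : manifold R n).
Variables (phi : tensor11 M) (xi : vfield M) (eta : oneform M) (g : metric M).

Definition almost_contact_metric : Prop :=
  [/\ forall p (v : tangent p),
        phi p (phi p v) = - v + eta p v *: field_at xi p,
      forall p, phi p (field_at xi p) = 0,
      forall p (v : tangent p), eta p (phi p v) = 0,
      forall p, eta p (field_at xi p) = 1 &
      (forall p (u v : tangent p),
         g p (phi p u) (phi p v) = g p u v - eta p u * eta p v) /\
      (forall p (v : tangent p), eta p v = g p v (field_at xi p))].

(* Exterior derivatives are normalised without the factors 1/2 and 1/3. *)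
Definition d_eta (X Y : vfield M) : Cinf M :=
  X (eval1 eta Y) - Y (eval1 eta X) - eval1 eta (bracket X Y).

Definition Phi (X Y : vfield M) : Cinf M := inner g X (tapp phi Y).

Definition d_Phi (X Y Z : vfield M) : Cinf M :=
  (X (Phi Y Z) : Cinf M) + Y (Phi Z X) + Z (Phi X Y)
  - Phi (bracket X Y) Z - Phi (bracket Y Z) X - Phi (bracket Z X) Y.

Definition nijenhuis (X Y : vfield M) : vfield M :=
  tapp phi (tapp phi (bracket X Y)) + bracket (tapp phi X) (tapp phi Y)
  - tapp phi (bracket (tapp phi X) Y) - tapp phi (bracket X (tapp phi Y)).

(* [phi, phi] + 2 d eta \otimes xi = 0, where 2 d eta in the normalisation of
   d with the factor 1/2 is d_eta. *)
Definition normal_structure : Prop :=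
  forall X Y, nijenhuis X Y + d_eta X Y *: xi = 0.

Definition cosymplectic : Prop :=
  [/\ almost_contact_metric, normal_structure,
      (forall X Y, d_eta X Y = 0) & (forall X Y Z, d_Phi X Y Z = 0)].

End AlmostContact.

Section Submersion.
Context {R : realType}.
Variables (m n : nat) (M : manifold R m) (N : manifold R n).
Variables (gM : metric M) (gN : metric N) (F : smooth_map M N).

Definition vertical (p : M) (v : tangent p) : Prop := differential F v = 0.

Definition horizontal (p : M) (v : tangent p) : Prop :=
  forall u : tangent p, vertical u -> gM p v u = 0.

Definition vertical_field (X : vfield M) : Prop :=
  forall p, vertical (field_at X p).

Definition horizontal_field (X : vfield M) : Prop :=
  forall p, horizontal (field_at X p).

Definition riemannian_submersion : Prop :=
  [/\ forall q, exists p, F p = q,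
      forall p (w : tangent (F p)), exists v : tangent p, differential F v = w
    & forall p (v : tangent p), horizontal v ->
        gN (F p) (differential F v) (differential F v) = gM p v v].

(* Characterises V and H pointwise, hence uniquely. *)
Definition orthogonal_projections (V H : tensor11 M) : Prop :=
  forall p (v : tangent p),
    [/\ v = V p v + H p v, vertical (V p v) & horizontal (H p v)].

Definition psi (V phi : tensor11 M) (U : vfield M) : vfield M :=
  tapp V (tapp phi U).

Definition omega (H phi : tensor11 M) (U : vfield M) : vfield M :=
  tapp H (tapp phi U).

(* Same formulas as psi and omega, meant for horizontal X. *)
Definition calB (V phi : tensor11 M) (X : vfield M) : vfield M :=
  tapp V (tapp phi X).

Definition calC (H phi : tensor11 M) (X : vfield M) : vfield M :=
  tapp H (tapp phi X).

Definition oneill_T (nabla : vfield M -> vfield M -> vfield M)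
    (V H : tensor11 M) (E G : vfield M) : vfield M :=
  tapp H (nabla (tapp V E) (tapp V G)) + tapp V (nabla (tapp V E) (tapp H G)).

Definition oneill_A (nabla : vfield M -> vfield M -> vfield M)
    (V H : tensor11 M) (E G : vfield M) : vfield M :=
  tapp V (nabla (tapp H E) (tapp H G)) + tapp H (nabla (tapp H E) (tapp V G)).

Definition vnorm (p : M) (v : tangent p) : R := Num.sqrt (gM p v v).

(* The angle between a vector w and ker F_* is the angle between w and its
   orthogonal projection to ker F_*. *)
Definition angle_ker (V : tensor11 M) (p : M) (w : tangent p) : R :=
  acos (vnorm (V p w) / vnorm w).

Definition slant (phi V : tensor11 M) (theta : R) : Prop :=
  forall p (v : tangent p), vertical v -> v != 0 ->
    angle_ker V (phi p v) = theta.

(* The second condition is nabF_v (Z \o F) = nabN_(F_* v) Z at every tangent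
   vector v of M: F_* v is the value at F p of some vector field W on N, and
   nabN_(F_* v) Z does not depend on the choice of W. *)
Definition pullback_connection (nabN : vfield N -> vfield N -> vfield N)
    (nabF : vfield M -> along F -> along F) : Prop :=
  is_connection nabF /\
  forall (X : vfield M) (W Z : vfield N) (p : M),
    differential F (field_at X p) = field_at W (F p) ->
    along_at (nabF X (comp_along F Z)) p = field_at (nabN W Z) (F p).

Definition second_fundamental_form (nabM : vfield M -> vfield M -> vfield M)
    (nabF : vfield M -> along F -> along F) (X Y : vfield M) : along F :=
  nabF X (push F Y) - push F (nabM X Y).

Definition totally_geodesic nabM nabF : Prop :=
  forall X Y, second_fundamental_form nabM nabF X Y = 0.

End Submersion.

(* Main.v *)
(* On a cosymplectic manifold nabla phi = 0 and nabla xi = 0, which follows by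
   linear algebra from normality and the closedness of eta and Phi. For V
   vertical and X horizontal, applying phi twice to nabla_E V and using
   psi^2 = - cos^2 theta on ker F_* gives
     sin^2 theta g(nabla_E V, X) = g(V nabla_E omega V, B X)
       + g(H nabla_E omega V, C X) - g(H nabla_E omega psi V, X),
   so the two displayed conditions say that the horizontal part of nabla_E V
   vanishes for E vertical and for E horizontal, that is, that the second
   fundamental form of F vanishes on (E, V).
   The second fundamental form is symmetric because the pullback connection is
   torsion free, and it always vanishes on pairs of horizontal fields: calling
   it B, the form g_N(B(X, Y), F_* Z) is symmetric in X, Y and, both connections
   being metric, skew in Y, Z. These two facts require computing the pullback
   connection on an arbitrary section of the pullback bundle, hence local frames
   of N made of global vector fields; since tangent vectors are abstract
   derivations, such frames come from bump functions and Hadamard's lemma. *)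
Require Import Defs.
From HB Require Import structures.
From mathcomp Require Import all_boot all_order all_algebra.
From mathcomp Require Import boolp classical_sets functions reals.
From mathcomp Require Import interval_inference.
From mathcomp Require Import topology normedtype landau derive trigo.
From mathcomp Require Import ereal sequences realfun exp.
From mathcomp Require Import measure lebesgue_measure lebesgue_integral ftc.
From mathcomp Require Import ring lra.
Set Implicit Arguments.
Unset Strict Implicit.
Unset Printing Implicit Defensive.
Import Order.TTheory GRing.Theory Num.Theory.
Import numFieldNormedType.Exports.
Local Open Scope classical_set_scope.
Local Open Scope ring_scope.

(** * Averages over the unit interval *)

Section UnitInterval.
Context {R : realType}.
Implicit Types f g : R -> R.

Definition mean01 f : R := \int[lebesgue_measure]_(t in `[0, 1]) f t.

Let integrable01 f : {within `[0, 1], continuous f} ->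
  lebesgue_measure.-integrable `[0, 1] (EFin \o f).
Proof.
by move=> cf; apply: continuous_compact_integrable => //; exact: segment_compact.
Qed.

Lemma mean01D f g : {within `[0, 1], continuous f} ->
  {within `[0, 1], continuous g} ->
  mean01 (fun t => f t + g t) = mean01 f + mean01 g.
Proof. by move=> cf cg; rewrite /mean01 RintegralD//; exact: integrable01. Qed.

Lemma mean01B f g : {within `[0, 1], continuous f} ->
  {within `[0, 1], continuous g} ->
  mean01 (fun t => f t - g t) = mean01 f - mean01 g.
Proof. by move=> cf cg; rewrite /mean01 RintegralB//; exact: integrable01. Qed.

Lemma mean01Z a f : {within `[0, 1], continuous f} ->
  mean01 (fun t => a * f t) = a * mean01 f.
Proof. by move=> cf; rewrite /mean01 RintegralZl//; exact: integrable01. Qed.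

Lemma mean01_cst a : mean01 (fun=> a) = a.
Proof.
by rewrite /mean01 Rintegral_cst//= lebesgue_measure_itv/= lte_fin ltr01 oppr0 addr0 mulr1.
Qed.

Lemma le_norm_mean01 f e : {within `[0, 1], continuous f} ->
  (forall t : R, t \in `[0, 1] -> `|f t| <= e) -> `|mean01 f| <= e.
Proof.
move=> cf fe; rewrite -[leRHS]mean01_cst /mean01.
have cn : {within `[0, 1], continuous (fun t => `|f t|)}.
  by move=> t; apply: continuous_comp; [exact: cf|exact: norm_continuous].
apply: (le_trans (le_normr_Rintegral _ (integrable01 cf))) => //.
apply: le_Rintegral => //; first exact: integrable01 cn.
by apply: integrable01 => t; exact: cst_continuous.
Qed.

Lemma mean01_deriv f g : {within `[0, 1], continuous f} ->
  {within `[0, 1], continuous g} ->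
  (forall t : R, t \in `]0, 1[ -> is_derive t 1 g (f t)) ->
  mean01 f = g 1 - g 0.
Proof.
move=> cf cg dg; rewrite /mean01 /Rintegral (@continuous_FTC2 _ f g)//.
  have [_ g0 g1] := (continuous_within_itvP g ltr01).1 cg.
  by split=> // t t01; have [] := dg _ t01.
by move=> t t01; rewrite derive1E; have [] := dg _ t01.
Qed.

Lemma within_continuousZ a f : {within `[0, 1], continuous f} ->
  {within `[0, 1], continuous (fun t => a * f t)}.
Proof.
by move=> cf t; apply: continuous_comp; [exact: cf|exact: mulrl_continuous].
Qed.

Lemma within_continuousBE f g : {within `[0, 1], continuous f} ->
  {within `[0, 1], continuous g} ->
  {within `[0, 1], continuous (fun t => f t - g t)}.
Proof. by move=> cf cg; have := within_continuousB cf cg. Qed.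

Lemma within_continuous_sum m (F : 'I_m -> R -> R) :
  (forall i, {within `[0, 1], continuous (F i)}) ->
  {within `[0, 1], continuous (fun t => \sum_i F i t)}.
Proof.
move=> cF; rewrite (_ : (fun t => _) = \sum_i F i); last first.
  by apply/funext => t; rewrite fct_sumE.
elim/big_ind : _ => [t|f g cf cg|//]; first exact: cst_continuous.
exact: within_continuousD.
Qed.

Lemma mean01_sum m (F : 'I_m -> R -> R) :
  (forall i, {within `[0, 1], continuous (F i)}) ->
  mean01 (fun t => \sum_i F i t) = \sum_i mean01 (F i).
Proof.
elim: m F => [|m IH] F cF.
  rewrite big_ord0 -[RHS](@mean01_cst 0); congr mean01; apply/funext => t.
  by rewrite big_ord0.
rewrite big_ord_recl -IH// -mean01D//; last exact: within_continuous_sum.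
by congr mean01; apply/funext => t; rewrite big_ord_recl.
Qed.

End UnitInterval.

(** * Linear forms and total differentials of functions of several variables *)

Section RowVectors.
Context {R : realType}.
Variable n : nat.
Implicit Types x h : 'rV[R]_n.

Lemma le_norm_coord x i : `|x 0 i| <= `|x|.
Proof.
rewrite [leRHS]mx_normrE.
exact: (le_bigmax _ (fun ij => `|x ij.1 ij.2|) (ord0, i)).
Qed.

Section LinearForm.
Variable a : 'I_n -> R.
Definition linear_form x : R := \sum_i x 0 i * a i.

Let linear_form_is_linear : linear linear_form.
Proof.
move=> c u v; rewrite /linear_form scaler_sumr -big_split/=.
by apply: eq_bigr => i _; rewrite !mxE mulrDl scalerAl.
Qed.
HB.instance Definition _ :=
  GRing.isLinear.Build R 'rV[R]_n R _ linear_form linear_form_is_linear.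

Lemma linear_form_delta i : linear_form (delta_mx 0 i) = a i.
Proof.
rewrite /linear_form (bigD1 i)//= big1 ?addr0; last first.
  by move=> j ji; rewrite mxE (negbTE ji) andbF mul0r.
by rewrite mxE !eqxx mul1r.
Qed.

Lemma linear_form_continuous : continuous linear_form.
Proof.
rewrite (_ : linear_form = \sum_i (fun x => x 0 i * a i)); last first.
  by apply/funext => x; rewrite fct_sumE.
elim/big_ind : _ => [|f g cf cg|i _].
- exact: cst_continuous.
- by move=> x; apply: continuousD; [exact: cf|exact: cg].
- move=> x; apply: continuousM; first exact: coord_continuous.
  exact: cst_continuous.
Qed.

(** A first-order expansion with a continuous linear part determines the differential, so one
    estimate yields both differentiability and the partial derivatives. It serves for functions
    given by integrals, where no rule of calculus applies directly. *)
Lemma differentiable_linear_form (f : 'rV[R]_n -> R) x :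
  (forall e, 0 < e ->
     \forall h \near (0 : 'rV[R]_n), `|f (x + h) - f x - linear_form h| <= e * `|h|) ->
  differentiable f x /\ 'd f x = linear_form :> ('rV[R]_n -> R).
Proof.
move=> H; pose z : {linear 'rV[R]_n -> R} := linear_form.
have E : (f \o shift x : _ -> R^o) = cst (f x) + z +o_ (0 : 'rV[R]_n) id.
  apply/eqaddoP => _/posnumP[e]; apply: filterS (H _ [gt0 of e%:num]) => h.
  by rewrite !fctE/= [h + x]addrC opprD addrA.
have cz : continuous z by exact: linear_form_continuous.
by split; [apply/diff_locallyP|]; rewrite (diff_unique cz E).
Qed.
End LinearForm.

Lemma diff_partialE (f : 'rV[R]_n -> R) x : differentiable f x ->
  'd f x = linear_form (fun i => 'D_(delta_mx 0 i) f x) :> ('rV[R]_n -> R).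
Proof.
move=> df; apply/funext => h; rewrite {1}[h]row_sum_delta linear_sum/=.
by apply: eq_bigr => i _; rewrite linearZ/= deriveE.
Qed.

End RowVectors.

(** * Hadamard's lemma *)

Section Hadamard.
Context {R : realType}.
Variables (n : nat) (U : set 'rV[R]_n) (x0 : 'rV[R]_n).
Hypothesis oU : open U.
Hypothesis starU : forall x (t : R), U x -> t \in `[0, 1] -> U (x0 + t *: (x - x0)).
Implicit Types (f : 'rV[R]_n -> R) (x y h : 'rV[R]_n) (s t e : R).

Lemma continuous_near f x :
  (forall e, 0 < e -> \forall y \near x, `|f x - f y| <= e) ->
  {for x, continuous f}.
Proof.
move=> H; have F : Filter (nbhs x) by exact: nbhs_filter.
by apply: (cvgrPdist_le (FF := F) f (f x)).2.
Qed.

Lemma Ck_continuous k f : Ck k U f -> forall x, U x -> {for x, continuous f}.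
Proof. by elim: k f => // k IH f /CkW; exact: IH. Qed.

Lemma near_add x (P : set 'rV[R]_n) :
  (\forall h \near (0 : 'rV[R]_n), P (x + h)) -> \forall y \near x, P y.
Proof.
by rewrite (near_shift 0 x); apply: filterS => h /=; rewrite subr0 addrC.
Qed.

Lemma near_addN x (P : set 'rV[R]_n) :
  (\forall y \near x, P y) -> \forall h \near (0 : 'rV[R]_n), P (x + h).
Proof.
by rewrite (near_shift 0 x); apply: filterS => h /=; rewrite subr0 addrC.
Qed.

Lemma line_is_derive f (y h : 'rV[R]_n) (s : R) : differentiable f (y + s *: h) ->
  is_derive s 1 (fun s : R => f (y + s *: h)) ('d f (y + s *: h) h).
Proof.
move=> df; have E : (fun r : R => r^-1 *: (((fun s => f (y + s *: h)) \o shift s)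
    (r *: 1) - f (y + s *: h))) =
    (fun r => r^-1 *: ((f \o shift (y + s *: h)) (r *: h) - f (y + s *: h))).
  by apply/funext => r /=; rewrite [r *: 1]mulr1 scalerDl addrCA.
have dh : derivable f (y + s *: h) h by exact: diff_derivable.
rewrite (_ : 'd f _ h = 'D_h f (y + s *: h)); last by rewrite deriveE.
apply: DeriveDef.
  by rewrite /derivable E.
by rewrite /derive E.
Qed.

Lemma line_MVT f (y h : 'rV[R]_n) :
  (forall s : R, s \in `[0, 1] -> differentiable f (y + s *: h)) ->
  exists2 c : R, c \in `[0, 1] & f (y + h) - f y = 'd f (y + c *: h) h.
Proof.
move=> df; pose F (s : R) := f (y + s *: h).
pose dF (s : R) : R := 'd f (y + s *: h) h.
have dl (s : R) : s \in `[0, 1] -> is_derive s 1 F (dF s).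
  by move=> /df; exact: line_is_derive.
have cF : {within `[0, 1], continuous F}.
  by apply: derivable_within_continuous => s s01; have [] := dl s s01.
have dF1 (s : R) : s \in `]0, 1[ -> is_derive s 1 F (dF s).
  by move=> s01; apply: dl; exact: subset_itv_oo_cc s01.
have le01 : (0 : R) <= 1 by exact: ler01.
have [s s01 E] := MVT_segment le01 dF1 cF.
by exists s => //; move: E; rewrite /F /dF scale1r scale0r addr0 subr0 mulr1.
Qed.

(** Continuity gives the bound near each single [t]; compactness of the unit interval makes one
    neighbourhood of [h = 0] serve all [t] at once. This uniformity is what allows limits to pass
    under the integral. *)
Lemma segment_uniform f x e : (forall x, U x -> {for x, continuous f}) -> U x ->
  0 < e -> \forall h \near (0 : 'rV[R]_n), forall t : R, t \in `[0, 1] ->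
    `|f (x0 + t *: (x + h - x0)) - f (x0 + t *: (x - x0))| <= e.
Proof.
move=> cf Ux e0.
have /compact_near_coveringP K := @segment_compact R 0 1.
have := K 'rV[R]_n (nbhs (0 : 'rV[R]_n)) (fun h t =>
  `|f (x0 + t *: (x + h - x0)) - f (x0 + t *: (x - x0))| <= e) _.
apply=> t t01.
pose y := x0 + t *: (x - x0).
have cy : {for y, continuous f} by apply: cf; exact: starU.
have e2 : 0 < e / 2 by rewrite divr_gt0.
have ny : \forall z \near y, `|f y - f z| <= e / 2.
  by move/cvgrPdist_le : cy; exact.
have g1 : (x0 + z.1 *: (x + z.2 - x0)) @[z --> (t, (0 : 'rV[R]_n))] --> y.
  rewrite /y -[in y in _ --> y](addr0 x).
  apply: cvgD; first exact: cvg_cst.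
  apply: cvgZ; first exact: cvg_fst.
  apply: cvgB; last exact: cvg_cst.
  apply: cvgD; first exact: cvg_cst.
  exact: cvg_snd.
have g2 : (x0 + z.1 *: (x - x0)) @[z --> (t, (0 : 'rV[R]_n))] --> y.
  apply: cvgD; first exact: cvg_cst.
  apply: cvgZ; first exact: cvg_fst.
  exact: cvg_cst.
near=> z.
have h1 : `|f y - f (x0 + z.1 *: (x + z.2 - x0))| <= e / 2 by near: z; exact: g1 ny.
have h2 : `|f y - f (x0 + z.1 *: (x - x0))| <= e / 2 by near: z; exact: g2 ny.
rewrite /= (_ : _ - _ = (f y - f (x0 + z.1 *: (x - x0))) -
  (f y - f (x0 + z.1 *: (x + z.2 - x0)))); last by ring.
by rewrite (le_trans (ler_normB _ _))// (splitr e) lerD.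
Unshelve. all: by end_near. Qed.

(* Differentiating under the integral sign turns the weight [t ^+ j] into
   [t ^+ j.+1], so smoothness is proved for all weights at once. *)
Definition radial_mean (j : nat) f x : R :=
  mean01 (fun t => t ^+ j * f (x0 + t *: (x - x0))).

Let radial_cont j f x : (forall x, U x -> {for x, continuous f}) -> U x ->
  {within `[0, 1], continuous (fun t => t ^+ j * f (x0 + t *: (x - x0)))}.
Proof.
move=> cf Ux; pose p (t : R) := t ^+ j.
pose l (t : R) := x0 + t *: (x - x0).
apply: continuous_subspace_itv => t t01.
have cp : {for t, continuous p} by exact: exprn_continuous.
have cl : {for t, continuous l}.
  by apply: cvgD; [exact: cvg_cst|apply: cvgZ; [exact: cvg_id|exact: cvg_cst]].
have cfl : {for t, continuous (f \o l)}.
  by apply: continuous_comp => //; apply: cf; exact: starU.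
exact: (continuousM cp cfl).
Qed.

Lemma radial_mean_continuous j f x :
  (forall x, U x -> {for x, continuous f}) -> U x ->
  {for x, continuous (radial_mean j f)}.
Proof.
move=> cf Ux; apply: continuous_near => e e0; apply: near_add; near=> h.
have Uxh : U (x + h).
  by near: h; apply: near_addN; exact: open_nbhs_nbhs.
have Hu : forall t : R, t \in `[0, 1] ->
    `|f (x0 + t *: (x + h - x0)) - f (x0 + t *: (x - x0))| <= e.
  by near: h; exact: segment_uniform.
rewrite distrC -mean01B; [|exact: radial_cont..].
apply: le_norm_mean01 => [|t t01].
  exact: (within_continuousBE (@radial_cont j _ _ cf Uxh) (@radial_cont j _ _ cf Ux)).
rewrite -mulrBr normrM.
have /andP[t0 t1] : 0 <= t <= 1 by move: t01; rewrite in_itv.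
rewrite (le_trans (ler_piMl _ _))//; last exact: Hu.
by rewrite ger0_norm ?exprn_ge0// exprn_ile1.
Unshelve. all: by end_near. Qed.

(** The increment of the integrand is rewritten, by the mean value theorem on the segment from
    [q t x] to [q t x + t *: h], with partial derivatives at an intermediate point; these differ
    from the ones at [q t x] by an amount that is uniformly small in [t]. The factor [t] in the
    increment accounts for the new weight [t ^+ j.+1]. *)
Lemma radial_mean_differentiable j f x :
  (forall x, U x -> differentiable f x) ->
  (forall (i : 'I_n) x, U x -> {for x, continuous (fun x => 'D_(delta_mx 0 i) f x)}) ->
  U x ->
  differentiable (radial_mean j f) x /\ forall i : 'I_n,
  'D_(delta_mx 0 i) (radial_mean j f) x =
  radial_mean j.+1 (fun x => 'D_(delta_mx 0 i) f x) x.
Proof.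
move=> df cdf Ux.
have cf y : U y -> {for y, continuous f}.
  by move=> Uy; apply: differentiable_continuous; exact: df.
pose D (i : 'I_n) y := 'D_(delta_mx 0 i) f y.
pose a i := radial_mean j.+1 (D i) x.
suff H e : 0 < e -> \forall h \near (0 : 'rV[R]_n),
    `|radial_mean j f (x + h) - radial_mean j f x - linear_form a h| <= e * `|h|.
  have [dr dE] := differentiable_linear_form H.
  by split=> // i; rewrite deriveE// dE linear_form_delta.
(* The error is a sum of [n] coordinate errors, each at most [e'] times the norm of [h]; dividing by
   [n.+1] keeps [e'] positive also for [n = 0]. *)
move=> e0; pose e' := e / n.+1%:R.
have e'0 : 0 < e' by rewrite divr_gt0.
have nU : \forall h \near (0 : 'rV[R]_n), U (x + h).
  by apply: near_addN; exact: open_nbhs_nbhs.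
have nD : \forall h \near (0 : 'rV[R]_n), forall (i : 'I_n) (t : R), t \in `[0, 1] ->
    `|D i (x0 + t *: (x + h - x0)) - D i (x0 + t *: (x - x0))| <= e'.
  have F0 : Filter (nbhs (0 : 'rV[R]_n)) by exact: nbhs_filter.
  exact: (filter_forall F0 (fun i => segment_uniform (cdf i) Ux e'0)).
have [d /= d0 H] := (nbhs_ballP _ _).1 (filterI nU nD).
apply: (nbhs_ballP _ _).2; exists d => //= h; rewrite -ball_normE/= sub0r normrN => hd.
have Hs (s : R) : s \in `[0, 1] -> `|s *: h| < d.
  rewrite in_itv/= => /andP[s0 s1]; rewrite normrZ ger0_norm//.
  by rewrite (le_lt_trans _ hd)// ler_piMl.
(* The intermediate point supplied by the mean value theorem is not under control, so the estimate
   is needed at [s *: h] for every [s] in the unit interval; the ball contains all these points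
   together with [h]. *)
have {}H (s : R) : s \in `[0, 1] -> U (x + s *: h) /\
   forall (i : 'I_n) (t : R), t \in `[0, 1] ->
   `|D i (x0 + t *: (x + s *: h - x0)) - D i (x0 + t *: (x - x0))| <= e'.
  by move=> /Hs sd; apply: H; rewrite -ball_normE/= sub0r normrN.
have one01 : (1 : R) \in `[0, 1] by rewrite in_itv/= ler01 lexx.
have Uxh : U (x + h) by have [] := H 1 one01; rewrite scale1r.
pose q t y := x0 + t *: (y - x0).
(* Points of the segment are contractions of points [x + s *: h] of [U], hence lie in [U] by
   star-shapedness. *)
have qE t s : q t (x + s *: h) = q t x + s *: (t *: h).
  by rewrite /q (addrAC x) scalerDr addrA !scalerA (mulrC t).
have cD i y k : U y -> {within `[0, 1], continuous (fun t => t ^+ k * D i (q t y))}.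
  by move=> Uy; apply: radial_cont => // z; exact: cdf.
have lE : linear_form a h =
    mean01 (fun t => t ^+ j * linear_form (fun i => D i (q t x)) (t *: h)).
  rewrite (_ : (fun t => _) =
      (fun t => \sum_i h 0 i * (t ^+ j.+1 * D i (q t x)))); last first.
    apply/funext => t; rewrite /linear_form mulr_sumr.
    by apply: eq_bigr => i _; rewrite !mxE exprS; ring.
  rewrite mean01_sum => [|i]; last exact: within_continuousZ (cD i x _ Ux).
  by apply: eq_bigr => i _; rewrite mean01Z//; exact: cD.
have cl : {within `[0, 1], continuous
    (fun t => t ^+ j * linear_form (fun i => D i (q t x)) (t *: h))}.
  rewrite (_ : (fun t => _) =
      (fun t => \sum_i h 0 i * (t ^+ j.+1 * D i (q t x)))); last first.
    apply/funext => t; rewrite /linear_form mulr_sumr.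
    by apply: eq_bigr => i _; rewrite !mxE exprS; ring.
  by apply: within_continuous_sum => i; exact: within_continuousZ (cD i x _ Ux).
have cB := within_continuousBE (@radial_cont j _ _ cf Uxh) (@radial_cont j _ _ cf Ux).
rewrite lE /radial_mean -mean01B; [|exact: radial_cont..].
rewrite -mean01B//; apply: le_norm_mean01 => [|t t01].
  exact: (within_continuousBE cB cl).
rewrite -!mulrBr normrM.
have /andP[t0 t1] : 0 <= t <= 1 by move: t01; rewrite in_itv.
rewrite (le_trans (ler_piMl _ _))//.
  by rewrite ger0_norm ?exprn_ge0// exprn_ile1.
have -> : x0 + t *: (x + h - x0) = q t x + t *: h.
  by have := qE t 1; rewrite !scale1r.
have [s s01|c c01 ->] := @line_MVT f (q t x) (t *: h).
  by rewrite -qE; apply/df/starU => //; have [] := H s s01.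
have Uc : U (q t x + c *: (t *: h)).
  by rewrite -qE; apply/starU => //; have [] := H c c01.
rewrite diff_partialE; last exact: df.
rewrite -/(D _) /linear_form -sumrB.
rewrite (le_trans (ler_norm_sum _ _ _))//.
apply: (@le_trans _ _ (\sum_(i < n) e' * `|h|)); last first.
  rewrite sumr_const card_ord -mulr_natl mulrA ler_wpM2r// /e' mulrCA.
  by rewrite ler_piMr ?(ltW e0)// ler_pdivrMr// mul1r ler_nat.
apply: ler_sum => i _; rewrite -mulrBr normrM mulrC ler_pM//.
  by have [_ /(_ i t t01)] := H c c01; rewrite -/(q t _) qE.
rewrite mxE normrM (ger0_norm t0) (le_trans (ler_piMl _ _))//.
exact: le_norm_coord.
Qed.

Lemma Ck_radial_mean k j f : Ck k U f -> Ck k U (radial_mean j f).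
Proof.
elim: k j f => [|k IH] j f.
  by move=> cf x Ux; exact: radial_mean_continuous.
move=> [df Df].
have dr x : U x -> _ := radial_mean_differentiable j df (fun i => Ck_continuous (Df i)).
split=> [x Ux|i]; first by have [] := dr x Ux.
by apply: Ck_eq (IH j.+1 _ (Df i)) => // x Ux; have [_ ->] := dr x Ux.
Qed.

Lemma radial_mean_center f : radial_mean 0 f x0 = f x0.
Proof.
rewrite -[RHS]mean01_cst; congr mean01; apply/funext => t.
by rewrite expr0 mul1r subrr scaler0 addr0.
Qed.

(** This is the fundamental theorem of calculus along the segment from [x0] to [x]: the derivative
    of [f \o q] is a sum of partials with the constant weights [(x - x0) 0 i], which leave the
    integral. *)
Lemma hadamard f x : Ck 1 U f -> U x ->
  f x = f x0 +
    \sum_i (x - x0) 0 i * radial_mean 0 (fun x => 'D_(delta_mx 0 i) f x) x.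
Proof.
move=> [df cD] Ux; pose q t := x0 + t *: (x - x0).
pose D (i : 'I_n) t := 'D_(delta_mx 0 i) f (q t).
have cD1 i : {within `[0, 1], continuous (D i)}.
  have := @radial_cont 0 _ _ (cD i) Ux.
  by rewrite (_ : (fun t => _) = D i)//; apply/funext => t; rewrite expr0 mul1r.
have cf : {within `[0, 1], continuous (f \o q)}.
  apply: derivable_within_continuous => t t01.
  by have [] := line_is_derive (df _ (starU Ux t01)).
have -> : f x = f x0 + (f (q 1) - f (q 0)).
  by rewrite /q scale1r scale0r addr0 addrC subrK addrC subrK.
congr (_ + _).
have cl := within_continuous_sum (fun i => @within_continuousZ _ ((x - x0) 0 i) _ (cD1 i)).
rewrite -[LHS](@mean01_deriv _ _ (f \o q) cl cf); last first.
  move=> t t01; have := line_is_derive (df _ (starU Ux (subset_itv_oo_cc t01))).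
  rewrite diff_partialE//.
  exact/df/(starU Ux (subset_itv_oo_cc t01)).
rewrite mean01_sum => [|i]; last exact: within_continuousZ (cD1 i).
apply: eq_bigr => i _; rewrite mean01Z//; congr (_ * _); congr mean01.
by apply/funext => t; rewrite expr0 mul1r.
Qed.

End Hadamard.

(** * Bump functions *)

Section FlatFunction.
Context {R : realType}.

(* The powers of [t^-1] in front of [exp (- t^-1)] make the family [flat k]
   stable under differentiation. *)
Definition flat (k : nat) (t : R) : R :=
  if 0 < t then t^-1 ^+ k * expR (- t^-1) else 0.

Lemma flat_gt0 k t : 0 < t -> 0 < flat k t.
Proof. by move=> t0; rewrite /flat t0 mulr_gt0 ?expR_gt0// exprn_gt0// invr_gt0. Qed.

Lemma flat_le0 k t : t <= 0 -> flat k t = 0.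
Proof. by rewrite leNgt /flat => /negbTE ->. Qed.

Lemma flat_ge0 k t : 0 <= flat k t.
Proof. by have [t0|/flat_le0 ->] := ltP 0 t; [exact/ltW/flat_gt0|]. Qed.

(** For positive [t], a single term of the exponential series at [t^-1], the one of degree [k.+2],
    already dominates: two of its powers of [t^-1] remain after cancelling those of [flat k]. A
    quadratic bound forces the derivative at 0 to vanish. *)
Lemma flat_le_sqr k t : flat k t <= (k.+2)`!%:R * t ^+ 2.
Proof.
have [t0|/flat_le0 ->] := ltP 0 t; last by rewrite mulr_ge0// sqr_ge0.
have ti0 : 0 <= t^-1 by rewrite invr_ge0 ltW.
have h : t^-1 ^+ k.+2 / (k.+2)`!%:R <= expR t^-1.
  by apply: le_trans (expR_ge1Dxn k.+1 ti0); rewrite lerDr.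
have f0 : (0 : R) < (k.+2)`!%:R by rewrite ltr0n fact_gt0.
rewrite /flat t0 expRN ler_pdivrMr ?expR_gt0// -mulrA -ler_pdivrMl//.
rewrite -ler_pdivrMl ?exprn_gt0//; apply: le_trans h.
by rewrite -exprVn mulrCA -exprD add2n mulrC.
Qed.

Lemma is_derive_sqr_bound (f : R -> R) (C : R) : 0 < C -> f 0 = 0 ->
  (forall t, `|f t| <= C * t ^+ 2) -> is_derive (0 : R) 1 f 0.
Proof.
move=> C0 f0 fC.
have H : (h^-1 *: ((f \o shift 0) (h *: 1) - f 0)) @[h --> 0^'] --> (0 : R).
  apply/cvgrPdist_le => e e0; near=> h.
  have h0 : h != 0 by near: h; exact: nbhs_dnbhs_neq.
  rewrite sub0r normrN /= addr0 f0 subr0 [h *: 1]mulr1 normrM normfV.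
  rewrite ler_pdivrMl ?normr_gt0// (le_trans (fC h))//.
  rewrite -[h ^+ 2]ger0_norm ?sqr_ge0// normrX expr2 mulrA mulrC ler_wpM2l//.
  rewrite -ler_pdivlMl// mulrC.
  by near: h; apply: dnbhs0_le; rewrite divr_gt0.
by apply: DeriveDef; [exact: cvgP H|exact: (cvg_lim _ H)].
Unshelve. all: by end_near. Qed.

Lemma flat_is_derive k (t : R) :
  is_derive t 1 (flat k) (flat k.+2 t - k%:R * flat k.+1 t).
Proof.
have [t0|t0|<-] := ltgtP 0 t.
- pose g (s : R) := s^-1 ^+ k * expR (- s^-1).
  apply: (@near_eq_is_derive _ _ _ g).
    have np : \forall s \near t, 0 < s by apply: open_nbhs_nbhs; split=> //; exact: open_gt.
    by apply: filterS np => s s0; rewrite /flat s0.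
  have tn0 : t != 0 by rewrite gt_eqF.
  have di : is_derive t 1 (fun s : R => s^-1) (- t ^- 2).
    have := is_deriveV (f := id) tn0 (is_derive_id t 1).
    by rewrite [_ *: 1]mulr1.
  have dX := is_deriveX k di.
  have dE := @is_derive1_comp _ expR (fun s => - s^-1) t _ _
    (is_derive_expR _) (is_deriveN di).
  have := is_deriveM dX dE.
  rewrite /flat t0 => d.
  have gE : g = ((fun s : R => s^-1) ^+ k) * (expR \o (fun s : R => - s^-1)).
    by apply/funext => s; rewrite !fctE.
  rewrite gE; apply: (is_derive_eq d); rewrite !fctE -exprVn /GRing.scale/=.
  by case: k {g gE dX d} => [|k]; rewrite ?exprS /=; ring.
- apply: (@near_eq_is_derive _ _ _ (fun=> 0)).
    have nn : \forall s \near t, s < 0 by apply: open_nbhs_nbhs; split=> //; exact: open_lt.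
    by apply: filterS nn => s s0; rewrite flat_le0 ?ltW.
  rewrite !flat_le0 ?ltW// mulr0 subr0; exact: is_derive_cst.
- rewrite !flat_le0// mulr0 subr0.
  apply: (@is_derive_sqr_bound _ ((k.+2)`!%:R)).
  + by rewrite ltr0n fact_gt0.
  + exact: flat_le0.
  + by move=> s; rewrite ger0_norm ?flat_ge0//; exact: flat_le_sqr.
Qed.
End FlatFunction.

Section Bump.
Context {R : realType}.
Variable n : nat.
Implicit Types (f g : 'rV[R]_n -> R) (U : set 'rV[R]_n) (x : 'rV[R]_n).

Lemma Ck_coord k U (i : 'I_n) : Ck k U (fun x : 'rV[R]_n => x 0 i).
Proof.
case: k => [|k]; first by move=> x _; exact: coord_continuous.
split=> [x _|j]; first exact: differentiable_coord.
pose d : 'rV[R]_n := delta_mx 0 j.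
rewrite (_ : (fun x => _) = cst (d 0 i)); first exact: Ck_cst.
apply/funext => x; rewrite /derive; set q := fun h : R => _.
have H : q h @[h --> 0^'] --> d 0 i.
  apply: cvg_near_cst; near=> h.
  have h0 : h != 0 by near: h; exact: nbhs_dnbhs_neq.
  by rewrite /q /d /= !mxE addrK /GRing.scale/= mulKf.
exact: (cvg_lim _ H).
Unshelve. all: by end_near. Qed.

Lemma CkN k U f : open U -> Ck k U f -> Ck k U (- f).
Proof.
move=> oU cf; have := CkM oU (Ck_cst k U (-1)) cf.
by congr Ck; apply/funext => x; rewrite !fctE mulN1r.
Qed.

Lemma CkV k U f : open U -> (forall x, U x -> f x != 0) ->
  Ck k U f -> Ck k U (fun x => (f x)^-1).
Proof.
move=> oU f0; elim: k => [|k IH] cf.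
  by move=> x Ux; apply: continuousV; [exact: f0|exact: cf].
have [df Df] := cf; split=> [x Ux|i].
  by apply: differentiableV; [exact: df|exact: f0].
have cV := IH (CkW cf).
apply: Ck_eq (CkM oU (CkN oU (CkM oU cV cV)) (Df i)) => // x Ux.
rewrite deriveV; [|exact: f0|by apply: diff_derivable; exact: df].
by rewrite !fctE -expr2 exprVn.
Qed.

Lemma Ck_flat_comp k j U f : open U -> Ck k U f -> Ck k U (flat j \o f).
Proof.
have dflat i t : differentiable (flat i : R -> R) t.
  by apply/derivable1_diffP; have [] := flat_is_derive i t.
move=> oU; elim: k j => [|k IH] j cf.
  move=> x Ux; apply: continuous_comp; first exact: cf.
  by apply: differentiable_continuous; exact: dflat.
have [df Df] := cf; split=> [x Ux|i].
  by apply: differentiable_comp; [exact: df|exact: dflat].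
have c0 := CkW cf.
have cj := CkM oU (Ck_cst k U (- j%:R)) (IH j.+1 c0).
apply: Ck_eq (CkM oU (CkD oU (IH j.+2 c0) cj) (Df i)) => // x Ux.
rewrite [RHS]deriveE; last by apply: differentiable_comp; [exact: df|exact: dflat].
rewrite diff_comp//; [|exact: df].
rewrite /= (_ : 'd f x _ = 'D_(delta_mx 0 i) f x); last by rewrite deriveE//; exact: df.
have d := flat_is_derive j (f x).
have E (w : R) : 'd (flat j : R -> R) (f x) w = w * (flat j.+2 (f x) - j%:R * flat j.+1 (f x)).
  rewrite -(derive_val (is_derive := d)) deriveE//.
  by rewrite -[w in LHS]mulr1 -[w * 1]/(w *: (1 : R)) linearZ.
by rewrite E !fctE mulNr mulrC.
Qed.

(** The norm on row vectors is the maximum norm, which is not smooth; the squared Euclidean distance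
    is smooth and still controls it. *)
Definition sqr_dist (c x : 'rV[R]_n) : R := \sum_i (x 0 i - c 0 i) ^+ 2.

Lemma Ck_sqr_dist k U c : open U -> Ck k U (sqr_dist c).
Proof.
move=> oU; rewrite (_ : sqr_dist c =
  \sum_i (fun x => (x 0 i - c 0 i) ^+ 2)); last first.
  by apply/funext => x; rewrite fct_sumE.
apply: Ck_sum => // i.
have cd := CkD oU (Ck_coord k U i) (Ck_cst k U (- c 0 i)).
have := CkM oU cd cd; congr Ck.
Qed.

Lemma sqr_dist_continuous c : continuous (sqr_dist c).
Proof. by move=> x; apply: (@Ck_sqr_dist 0 setT c openT). Qed.

Lemma le_norm_sqr_dist c x r : 0 <= r -> sqr_dist c x <= r ^+ 2 -> `|x - c| <= r.
Proof.
move=> r0 h; rewrite [leLHS]mx_normrE; apply: bigmax_le => // -[i j] _ /=.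
rewrite ord1 !mxE -ler_sqr ?nnegrE// real_normK ?num_real// (le_trans _ h)//.
by rewrite /sqr_dist (bigD1 j)//= lerDl sumr_ge0// => ? _; exact: sqr_ge0.
Qed.

(** The bump is [u / (u + v)], where [u] is positive exactly for squared distance below [s] and [v]
    exactly above [s / 2]. The two ranges overlap, so the denominator never vanishes; the quotient
    is 0 where [u] is, and 1 where [v] is. The radius is [r / 2] so that the closed Euclidean ball
    [K] fits in the open ball of radius [r]. *)
Lemma bump_exists (c : 'rV[R]_n) (O : set 'rV[R]_n) : open O -> O c ->
  exists b : 'rV[R]_n -> R, exists2 K : set 'rV[R]_n,
    [/\ compact K, K `<=` O & forall x, ~ K x -> b x = 0] &
    smooth_on setT b /\ \forall x \near c, b x = 1.
Proof.
move=> oO Oc.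
have [r /= r0 rO] := (nbhs_ballP _ _).1 (open_nbhs_nbhs (conj oO Oc)).
have r20 : 0 <= r / 2 by rewrite divr_ge0// ltW.
pose s := (r / 2) ^+ 2.
have s0 : 0 < s by rewrite exprn_gt0// divr_gt0.
pose u x := flat 0 (s - sqr_dist c x).
pose v x := flat 0 (sqr_dist c x - s / 2).
have uv0 x : u x + v x != 0.
  rewrite gt_eqF//; have [h|h] := ltP 0 (s - sqr_dist c x).
    by rewrite ltr_pwDl ?flat_gt0// flat_ge0.
  rewrite ltr_wpDl ?flat_ge0// flat_gt0// subr_gt0.
  rewrite subr_le0 in h; rewrite (lt_le_trans _ h)// ltr_pdivrMr// ltr_pMr//.
  by rewrite ltr1n.
exists (fun x => u x / (u x + v x)), [set x | sqr_dist c x <= s]; split.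
- apply: bounded_closed_compact.
    exists (`|c| + r / 2); split=> [|B hB x /= /(le_norm_sqr_dist r20) h].
      exact: num_real.
    apply: le_trans (ltW hB).
    by rewrite -[x](subrK c) addrC (le_trans (ler_normD _ _))// lerD2l.
  have cK : closed (sqr_dist c @^-1` [set y | y <= s]).
    by apply: closed_comp => [? _|]; [exact: sqr_dist_continuous|exact: closed_le].
  exact: cK.
- move=> x /= /(le_norm_sqr_dist r20) h; apply: rO; rewrite -ball_normE/= distrC.
  rewrite (le_lt_trans h)//.
  by rewrite ltr_pdivrMr// ltr_pMr// ltr1n.
- move=> x /= /negP; rewrite -ltNge => /ltW h.
  by rewrite /u flat_le0 ?mul0r// subr_le0.
- move=> k; have oT : open [set: 'rV[R]_n] := openT.
  have cq := Ck_sqr_dist k c oT.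
  have cu : Ck k setT u.
    have := Ck_flat_comp 0 oT (CkD oT (Ck_cst k _ s) (CkN oT cq)).
    by congr Ck.
  have cv : Ck k setT v.
    have := Ck_flat_comp 0 oT (CkD oT cq (Ck_cst k _ (- (s / 2)))).
    by congr Ck.
  have uvT (x : 'rV[R]_n) : setT x -> (u + v) x != 0 by move=> _; exact: uv0.
  exact: CkM oT cu (CkV oT uvT (CkD oT cu cv)).
have : \forall x \near c, sqr_dist c x < s / 2.
  have nb : nbhs (sqr_dist c c) [set t | t < s / 2].
    apply: open_nbhs_nbhs; split; first exact: open_lt.
    rewrite /= /sqr_dist big1 ?divr_gt0// => i _.
    by rewrite subrr expr0n.
  exact: (@sqr_dist_continuous c c _ nb).
apply: filterS => x h; rewrite /v flat_le0 ?subr_le0 ?ltW// addr0 divff//.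
rewrite gt_eqF// flat_gt0// subr_gt0 (lt_trans h)//.
by rewrite ltr_pdivrMr// ltr_pMr// ltr1n.
Qed.

End Bump.

(** * Tangent vectors and local frames *)

Section SmoothFunctionAlgebra.
Context {R : realType}.
Variables (n : nat) (M : manifold R n).
Implicit Types (f g : Cinf M) (p : M) (a : R).

Lemma Cinf_inj f g : (forall p, f p = g p) -> f = g.
Proof. by move=> fg; apply: val_inj; apply/funext => p; exact: fg. Qed.

Lemma CinfD f g p : (f + g : Cinf M) p = f p + g p. Proof. by []. Qed.
Lemma CinfN f p : (- f : Cinf M) p = - f p. Proof. by []. Qed.
Lemma CinfM f g p : (f * g : Cinf M) p = f p * g p. Proof. by []. Qed.
Lemma CinfZ a f p : (a *: f : Cinf M) p = a * f p. Proof. by []. Qed.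
Lemma Cinf0 p : (0 : Cinf M) p = 0. Proof. by []. Qed.
Lemma Cinf1 p : (1 : Cinf M) p = 1. Proof. by []. Qed.

Lemma Cinf_sum (I : finType) (F : I -> Cinf M) p :
  (\sum_i F i : Cinf M) p = \sum_i F i p.
Proof. exact: (big_morph (fun f : Cinf M => f p) (fun f g => CinfD f g p)). Qed.

Definition CinfE := (CinfD, CinfN, CinfM, CinfZ, Cinf0, Cinf1, Cinf_sum).

Section AtPoint.
Variables (p : M) (v : tangent p).

Lemma tangentD f g : v (f + g) = v f + v g.
Proof. by have := tangent_linear v 1 f g; rewrite scale1r mul1r. Qed.

Lemma tangent0 : v 0 = 0.
Proof.
by have /eqP := tangentD 0 0; rewrite addr0 -subr_eq subrr eq_sym => /eqP.
Qed.

Lemma tangentZ a f : v (a *: f) = a * v f.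
Proof. by have := tangent_linear v a f 0; rewrite tangent0 !addr0. Qed.

Lemma tangentN f : v (- f) = - v f.
Proof. by rewrite -scaleN1r tangentZ mulN1r. Qed.

Lemma tangent_sum (I : finType) (F : I -> Cinf M) :
  v (\sum_i F i) = \sum_i v (F i).
Proof. exact: (big_morph _ tangentD tangent0). Qed.

Lemma tangent1 : v 1 = 0.
Proof.
have /eqP := tangent_leibniz v 1 1; rewrite mulr1 Cinf1 mul1r.
by rewrite -subr_eq subrr eq_sym => /eqP.
Qed.

End AtPoint.
End SmoothFunctionAlgebra.

(** * Extension by zero from a chart, and tangent vectors in coordinates *)

Section Charts.
Context {R : realType}.
Variables (n : nat) (M : manifold R n).
Implicit Types (c d : @chart R n M).

Lemma Ck_sub k (U V : set 'rV[R]_n) f : V `<=` U -> Ck k U f -> Ck k V f.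
Proof. by move=> VU cf; apply: Ck_local => x /VU Ux; exists U. Qed.

Lemma chart_preimage_open d (B : set 'rV[R]_n) : open B ->
  open (chart_dom d `&` d @^-1` B).
Proof.
move=> oB; rewrite openE => q [dq Bq].
apply: filterI; first exact: open_nbhs_nbhs (conj (chart_dom_open d) dq).
by apply: (chart_fun_continuous dq); exact: open_nbhs_nbhs.
Qed.

Section ExtensionByZero.
Variables (d : @chart R n M) (B K : set 'rV[R]_n) (b : 'rV[R]_n -> R).
Hypotheses (Md : atlas d) (oB : open B) (Bd : B `<=` d @` chart_dom d).
Hypotheses (cK : compact K) (KB : K `<=` B).
Hypotheses (b0 : forall x, ~ K x -> b x = 0) (sb : smooth_on setT b).

Definition ext0 (u : 'rV[R]_n -> R) (q : M) : R :=
  if `[< chart_dom d q >] then b (d q) * u (d q) else 0.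

Lemma ext0E u q : chart_dom d q -> ext0 u q = b (d q) * u (d q).
Proof. by rewrite /ext0 => /asboolT ->. Qed.

Let KM := chart_inv d @` K.

Let KM_closed : closed KM.
Proof.
apply: compact_closed; first exact: manifold_hausdorff.
apply: continuous_compact => //; apply: continuous_in_subspaceT => x.
by rewrite inE => /KB/Bd; exact: chart_inv_continuous.
Qed.

Let ext0_off u q : ~ KM q -> ext0 u q = 0.
Proof.
rewrite /ext0; case: asboolP => // dq nK; rewrite b0 ?mul0r// => Kq.
by apply: nK; exists (d q) => //; rewrite chart_funK.
Qed.

(** Where [d] maps into [B] the function is a smooth expression in a coordinate change. Every other
    point lies off [KM], which is compact in a Hausdorff space and hence closed, so the function
    vanishes on a whole neighbourhood of it. *)
Lemma ext0_smooth u : smooth_on B u -> smooth_fun (ext0 u).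
Proof.
move=> su c Mc k; apply: Ck_local => _ [p cp <-].
have [[dp Bp]|npB] := pselect (chart_dom d p /\ B (d p)).
  pose U := c @` (chart_dom c `&` (chart_dom d `&` d @^-1` B)).
  have oU : open U by apply/chart_open_image/chart_preimage_open.
  exists U; first by exists p.
  have GB x : U x -> B (d (chart_inv c x)).
    by move=> [q [cq [_ Bq]] <-]; rewrite chart_funK.
  have sG j : smooth_on U (fun x => d (chart_inv c x) 0 j).
    move=> i; apply: Ck_sub (atlas_compatible Mc Md j i).
    by move=> _ [q [cq [dq _]] <-]; exists q.
  have cbu : Ck k B (b * u).
    by apply: CkM => //; apply: Ck_sub (sb k).
  apply: Ck_eq (Ck_comp oU GB sG cbu) => //.
  by move=> _ [q [cq [dq _]] <-]; rewrite /= !chart_funK// ext0E.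
have nKp : ~ KM p.
  move=> [x Kx xp]; apply: npB; have [q dq qx] := Bd (KB Kx).
  by rewrite -xp -qx chart_funK// qx; split=> //; exact: KB.
exists (c @` (chart_dom c `&` ~` KM)); first by exists p.
apply: Ck_eq (Ck_cst k _ 0); first exact: chart_open_image (closed_openC KM_closed).
by move=> _ [q [cq nK] <-]; rewrite chart_funK// ext0_off.
Qed.

End ExtensionByZero.

Lemma Cinf_bump (p : M) (O : set M) : open O -> O p ->
  exists2 chi : Cinf M, (\forall q \near p, chi q = 1) &
    forall q, ~ O q -> chi q = 0.
Proof.
move=> oO Op; have [d Md dp] := atlas_cover p.
have oB : open (d @` (chart_dom d `&` O)) by exact: chart_open_image.
have Bp : (d @` (chart_dom d `&` O)) (d p) by exists p.
have [b [K [cK KB b0] [sb b1]]] := bump_exists oB Bp.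
have Bd : d @` (chart_dom d `&` O) `<=` d @` chart_dom d.
  by move=> _ [q [dq _] <-]; exists q.
have s1 : smooth_on (d @` (chart_dom d `&` O)) (cst 1) by move=> k; exact: Ck_cst.
exists (mkCinf (ext0_smooth Md oB Bd cK KB b0 sb s1)).
  have nd : \forall q \near p, chart_dom d q.
    exact: open_nbhs_nbhs (conj (chart_dom_open d) dp).
  have nb : \forall q \near p, b (d q) = 1 by exact: (chart_fun_continuous dp b1).
  by apply: filterS2 nd nb => q dq bq /=; rewrite ext0E// bq mulr1.
move=> q nO /=; rewrite /ext0; case: asboolP => // dq.
rewrite b0 ?mul0r// => /KB[r [dr Or] rq]; apply: nO.
by rewrite -(chart_funK dq) -rq chart_funK.
Qed.

(** With a bump [chi] that is 1 at [p] and vanishes where [f] and [g] might differ, [chi * (f - g)]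
    is zero on all of [M], and the Leibniz rule at [p] turns this into [v (f - g) = 0]. *)
Lemma tangent_germ (p : M) (v : tangent p) (f g : Cinf M) :
  (\forall q \near p, f q = g q) -> v f = v g.
Proof.
move=> fg; have [chi chi1 chi0] := Cinf_bump (open_interior [set q | f q = g q]) fg.
have E : chi * (f - g) = 0.
  apply: Cinf_inj => q; rewrite !CinfE.
  have [|/chi0 ->] := pselect ([set q | f q = g q]^° q); last by rewrite mul0r.
  by move=> /interior_subset/= ->; rewrite subrr mulr0.
have := tangent_leibniz v chi (f - g); rewrite E tangent0 tangentD tangentN !CinfE.
rewrite (nbhs_singleton chi1) (nbhs_singleton fg) subrr mul0r addr0 mul1r.
by move/eqP; rewrite eq_sym subr_eq0 => /eqP.
Qed.

Lemma local_smooth d (f : Cinf M) : atlas d ->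
  smooth_on (d @` chart_dom d) (fun x => f (chart_inv d x)).
Proof. by move=> Md; exact: Cinf_smooth. Qed.

(** Hadamard's lemma writes [f] near [p] as [f p] plus the sum of [(y i - y i p) * G i]. A
    derivation at [p] kills the constant, and since [y i - y i p] vanishes at [p] only
    [v (y i) * G i p] survives, where [G i p] is the partial derivative. *)
Lemma tangent_coordE (p : M) (v : tangent p) d (y : 'I_n -> Cinf M) (f : Cinf M) :
  atlas d -> chart_dom d p -> (forall i, \forall q \near p, y i q = d q 0 i) ->
  v f = \sum_i v (y i) * 'D_(delta_mx 0 i) (fun x => f (chart_inv d x)) (d p).
Proof.
move=> Md dp yd; pose F x := f (chart_inv d x).
have sF : smooth_on (d @` chart_dom d) F by exact: local_smooth.
have nD : nbhs (d p) (d @` chart_dom d).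
  by apply: open_nbhs_nbhs; split; [exact: chart_img_open|exists p].
have [r /= r0 Bd] := (nbhs_ballP _ _).1 nD.
(* The chart image need not be star-shaped about [d p]; a ball inside it is. *)
pose B := ball (d p) r; have oB : open B by exact: ball_open.
have starB x (t : R) : B x -> t \in `[0, 1] -> B (d p + t *: (x - d p)).
  rewrite /B -ball_normE/= in_itv/= => xr /andP[t0 t1].
  rewrite opprD addrA subrr sub0r normrN normrZ ger0_norm//.
  by rewrite (le_lt_trans _ xr)// distrC ler_piMl.
have Bp : B (d p) by exact: ballxx.
have [b [K [cK KB b0] [sb b1]]] := bump_exists oB Bp.
pose g (i : 'I_n) := radial_mean (d p) 0 (fun x => 'D_(delta_mx 0 i) F x).
have cF k : Ck k B F by exact: Ck_sub (sF k).
have sg (i : 'I_n) : smooth_on B (g i).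
  by move=> k; have [_ DF] := cF k.+1; apply: Ck_radial_mean (DF i).
pose G (i : 'I_n) := mkCinf (ext0_smooth Md oB Bd cK KB b0 sb (sg i)).
pose h : Cinf M := f p *: (1 : Cinf M) + \sum_i (y i - y i p *: (1 : Cinf M)) * G i.
have fh : \forall q \near p, f q = h q.
  have nd : \forall q \near p, chart_dom d q.
    exact: open_nbhs_nbhs (conj (chart_dom_open d) dp).
  have nb : \forall q \near p, b (d q) = 1 by exact: (chart_fun_continuous dp b1).
  have nB : \forall q \near p, B (d q).
    exact: (chart_fun_continuous dp (open_nbhs_nbhs (conj oB Bp))).
  have ny := filter_forall (nbhs_filter p) yd.
  near=> q.
  have dq : chart_dom d q by near: q.
  have bq : b (d q) = 1 by near: q.
  have Bq : B (d q) by near: q.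
  have yq : forall i, y i q = d q 0 i by near: q.
  have := hadamard starB (cF 1%N) Bq.
  rewrite /F !chart_funK// => ->; rewrite !CinfE mulr1; congr (_ + _).
  apply: eq_bigr => i _; rewrite !CinfE mulr1 yq (nbhs_singleton (yd i)) !mxE.
  by rewrite /= ext0E// bq mul1r.
rewrite (tangent_germ v fh) tangentD tangentZ tangent1 mulr0 add0r tangent_sum.
apply: eq_bigr => i _; rewrite tangent_leibniz tangentD tangentN tangentZ tangent1.
rewrite !CinfE mulr1 mulr0 subrr mul0r add0r subr0 mulrC; congr (_ * _).
by rewrite /= ext0E// (nbhs_singleton b1) mul1r /g radial_mean_center.
Unshelve. all: by end_near. Qed.

End Charts.

Section DerivationAlgebra.
Context {R : realType}.
Variables (m n : nat) (M : manifold R m) (N : manifold R n).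
Variable h : Cinf N -> Cinf M.
Implicit Types (V W : derivation h) (a : Cinf M) (f : Cinf N).

Lemma derivation_inj V W : (forall f, V f = W f) -> V = W.
Proof. by move=> VW; apply: val_inj; apply/funext => f; exact: VW. Qed.

Lemma derivationD V W f : (V + W) f = V f + W f. Proof. by []. Qed.
Lemma derivationN V f : (- V) f = - V f. Proof. by []. Qed.
Lemma derivationZ a V f : (a *: V) f = a * (V f : Cinf M). Proof. by []. Qed.
Lemma derivation0 f : (0 : derivation h) f = 0. Proof. by []. Qed.

Lemma derivation_sum (I : finType) (F : I -> derivation h) f :
  (\sum_i F i) f = \sum_i F i f.
Proof. exact: (big_morph (fun V : derivation h => V f) (fun V W => derivationD V W f)). Qed.

Definition derivationE :=
  (derivationD, derivationN, derivationZ, derivation0, derivation_sum).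

End DerivationAlgebra.

Section LocalFrames.
Context {R : realType}.
Variables (n : nat) (M : manifold R n).

Section CoordinateField.
Variables (d : @chart R n M) (K : set 'rV[R]_n) (b : 'rV[R]_n -> R).
Hypotheses (Md : atlas d) (cK : compact K) (KD : K `<=` d @` chart_dom d).
Hypotheses (b0 : forall x, ~ K x -> b x = 0) (sb : smooth_on setT b).
Variable i : 'I_n.

Let partial (f : Cinf M) x := 'D_(delta_mx 0 i) (fun x => f (chart_inv d x)) x.

Let partial_smooth f : smooth_on (d @` chart_dom d) (partial f).
Proof. by move=> k; have [_] := local_smooth f Md k.+1; exact. Qed.

(** A coordinate derivation exists only on the domain of the chart; the cutoff [b] makes it a
    derivation of the global functions. *)
Definition coord_deriv (f : Cinf M) : Cinf M :=
  mkCinf (ext0_smooth Md (@chart_img_open _ _ _ d) (@subset_refl _ _) cK KD b0 sb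
    (partial_smooth f)).

Lemma coord_derivE f q : chart_dom d q ->
  coord_deriv f q = b (d q) * 'D_(delta_mx 0 i) (fun x => f (chart_inv d x)) (d q).
Proof. exact: ext0E. Qed.

Let coord_deriv_proof : (coord_deriv : Cinf M -> (Cinf M)^o) \in derivation_over (@id (Cinf M)).
Proof.
have df (f : Cinf M) q : chart_dom d q ->
    derivable (fun x => f (chart_inv d x)) (d q) (delta_mx 0 i).
  move=> dq; apply: diff_derivable; have [+ _] := local_smooth f Md 1%N.
  by apply; exists q.
apply/asboolP; split=> [a f g|f g]; apply: Cinf_inj => q.
  have [dq|ndq] := pselect (chart_dom d q); last first.
    by rewrite !CinfE /= /ext0; case: asboolP => // _; rewrite mulr0 addr0.
  rewrite !CinfE !coord_derivE//.
  have -> : (fun x => (a *: f + g : Cinf M) (chart_inv d x)) =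
    (a *: (fun x => f (chart_inv d x))) + (fun x => g (chart_inv d x)) by [].
  rewrite deriveD; [|exact/derivableZ/df|exact: df].
  rewrite deriveZ; last exact: df.
  by rewrite mulrDr mulrCA.
have [dq|ndq] := pselect (chart_dom d q); last first.
  by rewrite !CinfE /= /ext0; case: asboolP => // _; rewrite !mulr0 addr0.
rewrite !CinfE !coord_derivE//.
have -> : (fun x => (f * g : Cinf M) (chart_inv d x)) =
  (fun x => f (chart_inv d x)) * (fun x => g (chart_inv d x)) by [].
rewrite deriveM; [|exact: df..].
by rewrite /= !chart_funK// /GRing.scale/=; ring.
Qed.

Definition coord_field : vfield M := Derivation coord_deriv_proof.

Lemma coord_fieldE f q : chart_dom d q -> (coord_field f : Cinf M) q =
  b (d q) * 'D_(delta_mx 0 i) (fun x => f (chart_inv d x)) (d q).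
Proof. exact: ext0E. Qed.

End CoordinateField.

(* Multiplying by a bump function [chi] supported in a chart turns the local
   statement that the [Z i] are a frame dual to the [y i] into identities that
   hold on all of [M]. *)
Lemma local_frame (p : M) : exists chi : Cinf M, exists y : 'I_n -> Cinf M,
  exists Z : 'I_n -> vfield M,
  [/\ chi p = 1,
      forall q (v : tangent q) f,
        chi q * v f = chi q * \sum_i v (y i) * (Z i f : Cinf M) q
    & forall i j q, chi q * (Z i (y j) : Cinf M) q = chi q * (i == j)%:R].
Proof.
have [d Md dp] := atlas_cover p.
have oD := @chart_img_open _ _ _ d.
have Dp : (d @` chart_dom d) (d p) by exists p.
have [b [K [cK KD b0] [sb b1]]] := bump_exists oD Dp.
(* Over [W] the cutoff is invisible: the [y i] are the true coordinates and the [Z i] the true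
   coordinate fields. The second bump [chi] vanishes outside the preimage of [W]. *)
pose W := [set x | b x = 1]^°.
have oW : open W by exact: open_interior.
have [chi chi1 chi0] := Cinf_bump (chart_preimage_open d oW) (conj dp b1).
have sc (i : 'I_n) : smooth_on (d @` chart_dom d) (fun x => x 0 i).
  by move=> k; exact: Ck_coord.
pose y i := mkCinf (ext0_smooth Md oD (@subset_refl _ _) cK KD b0 sb (sc i)).
exists chi, y, (coord_field Md cK KD b0 sb).
have bW q : W (d q) -> b (d q) = 1 by move/interior_subset.
have yE i q : chart_dom d q -> W (d q) -> \forall r \near q, y i r = d r 0 i.
  move=> dq Wq.
  have nq := open_nbhs_nbhs (conj (chart_preimage_open d oW) (conj dq Wq)).
  by apply: filterS nq => r [dr Wr] /=; rewrite ext0E// bW// mul1r.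
split=> [|q v f|i j q].
- exact: nbhs_singleton chi1.
- have [[dq Wq]|/chi0 ->] := pselect ((chart_dom d `&` d @^-1` W) q); last by rewrite !mul0r.
  congr (_ * _); rewrite (tangent_coordE v f Md dq (fun i => yE i q dq Wq)).
  apply: eq_bigr => i _; congr (_ * _).
  by rewrite coord_fieldE// bW// mul1r.
have [[dq Wq]|/chi0 ->] := pselect ((chart_dom d `&` d @^-1` W) q); last by rewrite !mul0r.
congr (_ * _); rewrite coord_fieldE// bW// mul1r.
have nq : \forall x \near d q, (y j (chart_inv d x) : R) = x 0 j.
  have nW : nbhs (d q) (d @` (chart_dom d `&` (chart_dom d `&` d @^-1` W))).
    apply: open_nbhs_nbhs; split; last by exists q.
    exact/chart_open_image/chart_preimage_open.
  apply: filterS nW => _ [r [dr [_ Wr]] <-].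
  by rewrite chart_funK//= ext0E// bW// mul1r.
rewrite (near_eq_derive _ nq).
(* A coordinate is a linear form, hence its own differential, and its partial derivatives are
   Kronecker deltas. *)
have -> : (fun x : 'rV[R]_n => x 0 j) = linear_form (fun k => (k == j)%:R).
  apply/funext => x; rewrite /linear_form (bigD1 j)//= eqxx mulr1 big1 ?addr0//.
  by move=> k /negbTE ->; rewrite mulr0.
have [|df dE] := @differentiable_linear_form _ _ (fun k => (k == j)%:R)
    (linear_form (fun k => (k == j)%:R)) (d q).
  move=> e e0; near=> h.
  by rewrite linearD/= [X in X - _ - _]addrC addrK subrr normr0 mulr_ge0// ltW.
by rewrite deriveE// dE linear_form_delta.
Unshelve. all: by end_near. Qed.

Lemma tangent_extend (p : M) (v : tangent p) : exists X : vfield M, field_at X p = v.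
Proof.
have [chi [y [Z [chi1 H _]]]] := local_frame p.
exists (\sum_i (v (y i) *: (1 : Cinf M)) *: Z i).
apply: val_inj; apply/funext => f /=.
have := H p v f; rewrite chi1 !mul1r => ->.
rewrite derivationE Cinf_sum; apply: eq_bigr => i _.
by rewrite derivationE !CinfE mulr1.
Qed.

End LocalFrames.

(** * Vector fields, metrics and connections *)

Section FieldAlgebra.
Context {R : realType}.
Variables (n : nat) (M : manifold R n).
Implicit Types (X Y Z : vfield M) (a : Cinf M) (p : M).

Lemma field_at_inj X Y : (forall p, field_at X p = field_at Y p) -> X = Y.
Proof.
move=> XY; apply: derivation_inj => f; apply: Cinf_inj => p.
by have /(congr1 (fun v : tangent p => v f)) := XY p.
Qed.

Lemma field_atD X Y p : field_at (X + Y) p = field_at X p + field_at Y p.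
Proof. exact: val_inj. Qed.

Lemma field_atN X p : field_at (- X) p = - field_at X p.
Proof. exact: val_inj. Qed.

Lemma field_atZ a X p : field_at (a *: X) p = a p *: field_at X p.
Proof. exact: val_inj. Qed.

Lemma field_at0 p : field_at (0 : vfield M) p = 0.
Proof. exact: val_inj. Qed.

Lemma field_at_tapp (t : tensor11 M) X p : field_at (tapp t X) p = t p (field_at X p).
Proof. exact: val_inj. Qed.

Lemma tappD (t : tensor11 M) X Y : tapp t (X + Y) = tapp t X + tapp t Y.
Proof.
by apply: field_at_inj => p; rewrite field_atD !field_at_tapp field_atD raddfD.
Qed.

Lemma tappN (t : tensor11 M) X : tapp t (- X) = - tapp t X.
Proof.
by apply: field_at_inj => p; rewrite field_atN !field_at_tapp field_atN raddfN.
Qed.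

Lemma tapp0 (t : tensor11 M) : tapp t 0 = 0.
Proof. by apply: field_at_inj => p; rewrite field_at_tapp field_at0 raddf0. Qed.

Lemma vfieldD X (f f' : Cinf M) : X (f + f') = (X f : Cinf M) + X f'.
Proof. by have := deriv_linear X 1 f f'; rewrite !scale1r. Qed.

Lemma vfieldM X (f f' : Cinf M) : X (f * f') = f * (X f' : Cinf M) + f' * (X f : Cinf M).
Proof. exact: deriv_leibniz. Qed.

Lemma vfield0 X : X 0 = 0.
Proof.
by have /eqP := vfieldD X 0 0; rewrite addr0 -subr_eq subrr eq_sym => /eqP.
Qed.

Lemma vfield1 X : X 1 = 0.
Proof.
have /eqP := vfieldM X 1 1; rewrite mulr1 mul1r.
by rewrite -subr_eq subrr eq_sym => /eqP.
Qed.

Lemma vfield_sum X (I : finType) (F : I -> Cinf M) :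
  X (\sum_i F i) = \sum_i (X (F i) : Cinf M).
Proof. exact: (big_morph (fun f => X f : Cinf M) (vfieldD X) (vfield0 X)). Qed.

End FieldAlgebra.

Section MetricAlgebra.
Context {R : realType}.
Variables (n : nat) (M : manifold R n) (g : metric M).

Section AtPoint.
Variable p : M.
Implicit Types (u v w : tangent p) (a : R).

Lemma metricDl u v w : g p (u + v) w = g p u w + g p v w.
Proof. by have := metric_linear g 1 u v w; rewrite scale1r mul1r. Qed.

Lemma metric0l w : g p 0 w = 0.
Proof.
by have /eqP := metricDl 0 0 w; rewrite addr0 -subr_eq subrr eq_sym => /eqP.
Qed.

Lemma metricZl a u w : g p (a *: u) w = a * g p u w.
Proof. by have := metric_linear g a u 0 w; rewrite metric0l !addr0. Qed.

Lemma metricNl u w : g p (- u) w = - g p u w.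
Proof. by rewrite -scaleN1r metricZl mulN1r. Qed.

Lemma metricDr u v w : g p u (v + w) = g p u v + g p u w.
Proof. by rewrite Defs.metric_sym metricDl !(Defs.metric_sym g u). Qed.

Lemma metricZr a u w : g p u (a *: w) = a * g p u w.
Proof. by rewrite Defs.metric_sym metricZl Defs.metric_sym. Qed.

Lemma metricNr u w : g p u (- w) = - g p u w.
Proof. by rewrite Defs.metric_sym metricNl Defs.metric_sym. Qed.

Lemma metric0r w : g p w 0 = 0.
Proof. by rewrite Defs.metric_sym metric0l. Qed.

Lemma metric_sum2 (I J : finType) (b : I -> R) (c : J -> R)
    (u : I -> tangent p) (w : J -> tangent p) :
  g p (\sum_i b i *: u i) (\sum_j c j *: w j) =
  \sum_i \sum_j b i * c j * g p (u i) (w j).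
Proof.
rewrite (big_morph (fun x => g p x _) (fun x x' => metricDl x x' _) (metric0l _)).
apply: eq_bigr => i _.
rewrite (big_morph (fun x => g p _ x) (fun x x' => metricDr _ x x') (metric0r _)).
by apply: eq_bigr => j _; rewrite metricZl metricZr mulrA.
Qed.

Lemma metric_eq0 v : g p v v = 0 -> v = 0.
Proof. by have [//|/(metric_pos g)] := eqVneq v 0; move=> /[swap] ->; rewrite ltxx. Qed.

End AtPoint.

Definition metricE := (metricDl, metricNl, metricZl, metric0l,
  metricDr, metricNr, metricZr, metric0r).

Implicit Types (X Y Z : vfield M).

Lemma inner_sym X Y : inner g X Y = inner g Y X.
Proof. by apply: Cinf_inj => p; exact: Defs.metric_sym. Qed.

Lemma innerE X Y p : inner g X Y p = g p (field_at X p) (field_at Y p).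
Proof. by []. Qed.

Lemma inner_eq0 X : inner g X X = 0 -> X = 0.
Proof.
move=> X0; apply: field_at_inj => p; rewrite field_at0.
by apply: metric_eq0; rewrite -innerE X0.
Qed.

End MetricAlgebra.

Section Connection.
Context {R : realType}.
Variables (m n : nat) (M : manifold R m) (N : manifold R n).
Variables (h : Cinf N -> Cinf M).
Variable nabla : vfield M -> derivation h -> derivation h.
Hypothesis nabla_conn : is_connection nabla.
Implicit Types (X Y : vfield M) (W : derivation h) (a : Cinf M).

Lemma connectionDr X W W' : nabla X (W + W') = nabla X W + nabla X W'.
Proof. by have [_ + _] := nabla_conn; exact. Qed.

Lemma connectionZr X a W : nabla X (a *: W) = (X a : Cinf M) *: W + a *: nabla X W.
Proof. by have [_ _] := nabla_conn; exact. Qed.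

Lemma connection0r X : nabla X 0 = 0.
Proof.
by have /eqP := connectionDr X 0 0; rewrite addr0 -subr_eq subrr eq_sym => /eqP.
Qed.

Lemma connectionNr X W : nabla X (- W) = - nabla X W.
Proof.
by apply/eqP; rewrite -addr_eq0 -connectionDr addNr connection0r.
Qed.

Lemma connection_sumr X (I : finType) (F : I -> derivation h) :
  nabla X (\sum_i F i) = \sum_i nabla X (F i).
Proof. exact: (big_morph _ (connectionDr X) (connection0r X)). Qed.

Lemma connectionDl X Y W : nabla (X + Y) W = nabla X W + nabla Y W.
Proof. by have [+ _ _] := nabla_conn => /(_ 1 X Y W); rewrite !scale1r. Qed.

Lemma connection0l W : nabla 0 W = 0.
Proof.
by have /eqP := connectionDl 0 0 W; rewrite addr0 -subr_eq subrr eq_sym => /eqP.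
Qed.

Lemma connectionZl a X W : nabla (a *: X) W = a *: nabla X W.
Proof.
by have [+ _ _] := nabla_conn => /(_ a X 0 W); rewrite !addr0 connection0l addr0.
Qed.

End Connection.

(** * Cosymplectic structures *)

Section Cosymplectic.
Context {R : realType}.
Variables (n : nat) (M : manifold R n).
Variables (phi : tensor11 M) (xi : vfield M) (eta : oneform M) (g : metric M).
Variable nabla : vfield M -> vfield M -> vfield M.
Hypothesis contact : almost_contact_metric phi xi eta g.
Implicit Types (X Y Z : vfield M) (p : M).

Lemma phi_sqr p (v : tangent p) :
  phi p (phi p v) = - v + g p v (field_at xi p) *: field_at xi p.
Proof. by have [e _ _ _ [_ e']] := contact; rewrite e e'. Qed.

Lemma metric_xi_xi p : g p (field_at xi p) (field_at xi p) = 1.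
Proof. by have [_ _ _ e [_ e']] := contact; rewrite -e' e. Qed.

Lemma metric_phi_xi p (v : tangent p) : g p (phi p v) (field_at xi p) = 0.
Proof. by have [_ _ e _ [_ e']] := contact; rewrite -e' e. Qed.

Lemma metric_phi_phi p (u v : tangent p) :
  g p (phi p u) (phi p v) = g p u v - g p u (field_at xi p) * g p v (field_at xi p).
Proof. by have [_ _ _ _ [e e']] := contact; rewrite e !e'. Qed.

Lemma metric_phi_skew p (u v : tangent p) : g p (phi p u) v = - g p u (phi p v).
Proof.
have := metric_phi_phi u (phi p v); rewrite phi_sqr !metricE !metric_phi_xi.
by rewrite !mulr0 subr0 addr0 => <-; rewrite opprK.
Qed.

Lemma tapp_phi_sqr X : tapp phi (tapp phi X) = - X + inner g X xi *: xi.
Proof.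
apply: field_at_inj => p.
by rewrite !field_at_tapp phi_sqr field_atD field_atN field_atZ.
Qed.

Lemma tapp_phi_xi : tapp phi xi = 0.
Proof.
apply: field_at_inj => p; rewrite field_at_tapp field_at0.
by have [_ -> _ _ _] := contact.
Qed.

Lemma eval1_inner X : eval1 eta X = inner g X xi.
Proof. by apply: Cinf_inj => p; have [_ _ _ _ [_ /= ->]] := contact. Qed.

Hypothesis normal_phi : normal_structure phi xi eta.
Hypothesis closed_eta : forall X Y, d_eta eta X Y = 0.
Hypothesis closed_Phi : forall X Y Z, d_Phi phi g X Y Z = 0.
Hypothesis nablaLC : levi_civita g nabla.

Let conn : is_connection nabla. Proof. by have [] := nablaLC. Qed.

Let torsion X Y : bracket X Y = nabla X Y - nabla Y X.
Proof. by have [_ -> _] := nablaLC. Qed.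

Let compat X Y Z p : (X (inner g Y Z) : Cinf M) p =
  inner g (nabla X Y) Z p + inner g Y (nabla X Z) p.
Proof. by have [_ _ ->] := nablaLC. Qed.

Definition nabla_phi X Y : vfield M := nabla X (tapp phi Y) - tapp phi (nabla X Y).

(** [Om] and [A] are the covariant derivatives of [phi] and [xi] with an index lowered by [g].
    Normality and closedness become linear identities between their values, and the vanishing of
    both is then linear algebra. *)
Let Om p X Y Z : R := inner g (nabla_phi X Y) Z p.
Let A p X Y : R := inner g (nabla X xi) Y p.

Let OmE p X Y Z :
  Om p X Y Z = inner g (nabla X (tapp phi Y)) Z p + inner g (nabla X Y) (tapp phi Z) p.
Proof.
rewrite /Om /nabla_phi !innerE field_atD field_atN !field_at_tapp !metricE.
by rewrite metric_phi_skew opprK.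
Qed.

Let inner_lin p X Y Z (a : Cinf M) :
  inner g X (- Y + a *: Z) p = - inner g X Y p + a p * inner g X Z p.
Proof. by rewrite !innerE field_atD field_atN field_atZ !metricE. Qed.

Let skewE p X Y : inner g (tapp phi X) Y p = - inner g X (tapp phi Y) p.
Proof. by rewrite !innerE !field_at_tapp metric_phi_skew. Qed.

Let symE p X Y : inner g X Y p = inner g Y X p.
Proof. by rewrite inner_sym. Qed.

Let Om_skew p X Y Z : Om p X Y Z = - Om p X Z Y.
Proof.
have e1 := compat X (tapp phi Y) Z p.
have e2 := compat X Y (tapp phi Z) p.
have e3 : (X (inner g (tapp phi Y) Z) : Cinf M) p = - (X (inner g Y (tapp phi Z)) : Cinf M) p.
  have -> : inner g (tapp phi Y) Z = - inner g Y (tapp phi Z).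
    by apply: Cinf_inj => q; rewrite CinfN skewE.
  have /eqP := vfieldD X (inner g Y (tapp phi Z)) (- inner g Y (tapp phi Z)).
  by rewrite subrr vfield0 eq_sym addr_eq0 => /eqP ->; rewrite CinfN opprK.
rewrite !OmE (symE _ (nabla X (tapp phi Z))) (symE _ (nabla X Z)).
lra.
Qed.

Let A_sym p X Y : A p X Y = A p Y X.
Proof.
have := congr1 (fun f : Cinf M => f p) (closed_eta X Y).
rewrite /d_eta !eval1_inner !CinfE !compat torsion !innerE.
rewrite field_atD field_atN !metricE /A !innerE.
rewrite (Defs.metric_sym g (field_at Y p)).
rewrite (Defs.metric_sym g (field_at X p) (field_at _ p)) => h; lra.
Qed.

Let A_xi p X : A p X xi = 0.
Proof.
have := compat X xi xi p.
have -> : inner g xi xi = 1 by apply: Cinf_inj => q; exact: metric_xi_xi.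
rewrite vfield1 Cinf0 (symE _ xi) /A; lra.
Qed.

(** With brackets expressed by the torsion-free [nabla], the exterior derivative of [Phi] is, up to
    sign, the cyclic sum of its covariant derivative. *)
Let Om_cyclic p X Y Z : Om p X Y Z + Om p Y Z X + Om p Z X Y = 0.
Proof.
have := congr1 (fun f : Cinf M => f p) (closed_Phi X Y Z).
rewrite /d_Phi /Phi !CinfE !compat !torsion.
rewrite ![inner g (nabla _ _ - nabla _ _) _ p]innerE.
rewrite !field_atD !field_atN !metricE -!innerE.
rewrite (Om_skew _ X) (Om_skew _ Y) (Om_skew _ Z) !OmE.
rewrite (symE _ Y (nabla X _)) (symE _ Z (nabla Y _)) (symE _ X (nabla Z _)).
lra.
Qed.

(** As [eta] is closed, normality is the vanishing of the Nijenhuis tensor; writing its brackets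
    through [nabla] leaves only derivatives of [phi]. *)
Let Om_normal p X Y Z :
  Om p (tapp phi X) Y Z - Om p (tapp phi Y) X Z
  + Om p X Y (tapp phi Z) - Om p Y X (tapp phi Z) = 0.
Proof.
have := normal_phi X Y; rewrite closed_eta scale0r addr0 /nijenhuis !torsion !(tappD, tappN).
move/(congr1 (fun V => g p (field_at V p) (field_at Z p))).
rewrite !(field_atD, field_atN, field_at_tapp, field_at0, metricE).
rewrite /Om /nabla_phi !innerE !(field_atD, field_atN, field_at_tapp, metricE).
rewrite !metric_phi_skew; lra.
Qed.

Let Om_xi p X Z : Om p X xi Z = A p X (tapp phi Z).
Proof.
by rewrite OmE tapp_phi_xi (connection0r conn) innerE field_at0 metricE add0r.
Qed.

(** With [xi] as an argument, the cyclic and the normality identities both contain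
    [Om xi Y (phi Z)]; eliminating it and using the symmetry of [A] leaves
    [2 A (phi Y) (phi Z) = 0]. Applying this to images under [phi] removes [phi], because [phi]
    squared is minus the identity up to multiples of [xi], which [A] ignores. *)
Lemma nabla_xi X : nabla X xi = 0.
Proof.
have e p V W : A p V (- W + inner g W xi *: xi) = - A p V W.
  rewrite /A inner_lin; by have := A_xi p V; rewrite /A => ->; rewrite mulr0 addr0.
have H p Y Z : A p (tapp phi Y) (tapp phi Z) = 0.
  have c := Om_cyclic p Y (tapp phi Z) xi.
  have := Om_normal p Y xi Z.
  rewrite tapp_phi_xi !Om_xi => N.
  have O0 : Om p 0 Y Z = 0.
    rewrite OmE !(connection0l conn) !innerE field_at0 !metricE; lra.
  rewrite (Om_skew _ Y) !Om_xi tapp_phi_sqr in c.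
  rewrite tapp_phi_sqr in N.
  have s := A_sym p (tapp phi Z) (tapp phi Y).
  rewrite e in c; rewrite e in N; lra.
apply: (@inner_eq0 _ _ _ g); apply: Cinf_inj => p; rewrite Cinf0.
have := H p (tapp phi X) (tapp phi (nabla X xi)).
by rewrite !tapp_phi_sqr e (A_sym p _ (nabla X xi)) e opprK A_sym.
Qed.

(** Differentiating [phi^2 = - I + eta \otimes xi], whose right-hand side is parallel since [xi] is,
    shows that [nabla phi] anticommutes with [phi]; [phi] is also skew. *)
Let Om_phi p X Y Z : Om p X (tapp phi Y) Z = Om p X Y (tapp phi Z).
Proof.
rewrite !OmE !tapp_phi_sqr (connectionDr conn) (connectionNr conn).
rewrite (connectionZr conn) nabla_xi scaler0 addr0.
have c : (X (inner g Y xi) : Cinf M) p = inner g (nabla X Y) xi p.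
  by rewrite compat nabla_xi (innerE _ _ 0) field_at0 metricE addr0.
rewrite !innerE !(field_atD, field_atN, field_atZ, metricE) c -!innerE (symE _ xi).
lra.
Qed.

Lemma nabla_phi0 X Y : nabla X (tapp phi Y) = tapp phi (nabla X Y).
Proof.
(* [S] is symmetric in its first two and skew in its last two arguments. *)
pose S p U V W := Om p (tapp phi U) V W + Om p U V (tapp phi W).
have S12 p U V W : S p U V W = S p V U W.
  by have := Om_normal p U V W; rewrite /S; lra.
have S23 p U V W : S p U V W = - S p U W V.
  rewrite /S (Om_skew p _ V W) (Om_skew p U W) Om_phi; lra.
have S0 p U V W : S p U V W = 0.
  have := S12 p U V W; have := S23 p U V W; have := S12 p U W V.
  have := S23 p W U V; have := S12 p V W U; have := S23 p V U W; lra.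
(* The sum of the cyclic identities for [(phi U, V, W)] and [(U, V, phi W)] is
   [S U V W + S W U V + 2 Om V (phi W) U = 0], after moving [phi] with [Om_phi]. *)
have H p U V W : Om p V (tapp phi W) U = 0.
  have c1 := Om_cyclic p (tapp phi U) V W.
  have c2 := Om_cyclic p U V (tapp phi W).
  have := S0 p U V W; have := S0 p W U V; rewrite /S => s1 s2.
  have o1 := Om_phi p V W U; have o2 := Om_phi p W U V; lra.
suff: nabla_phi X Y = 0 by move/eqP; rewrite subr_eq0 => /eqP.
apply: (@inner_eq0 _ _ _ g); apply: Cinf_inj => p; rewrite Cinf0.
set P := nabla_phi X Y; rewrite -/(Om p X Y P).
(* Taking [W = phi P] produces [phi^2 P], that is [- P] up to a multiple of [xi] which contributes
   nothing as [xi] is parallel; what remains is the squared length of [P]. *)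
have := H p Y X (tapp phi P); rewrite tapp_phi_sqr Om_skew.
have -> : Om p X Y (- P + inner g P xi *: xi) = - Om p X Y P.
  rewrite {1}/Om inner_lin -/(Om p X Y xi) -/(Om p X Y P).
  rewrite (Om_skew p X Y xi) Om_xi /A nabla_xi (innerE g 0) field_at0 metricE.
  by rewrite oppr0 mulr0 addr0.
by rewrite opprK.
Qed.

End Cosymplectic.

(** * Slant Riemannian submersions *)

Section Projections.
Context {R : realType}.
Variables (m n : nat) (M : manifold R m) (N : manifold R n).
Variables (g : metric M) (F : smooth_map M N) (PV PH : tensor11 M).
Hypothesis projVH : orthogonal_projections g F PV PH.
Implicit Types (p : M) (X Y : vfield M).

Lemma differentialD p (u v : tangent p) :
  differential F (u + v) = differential F u + differential F v.
Proof. exact: val_inj. Qed.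

Lemma differentialZ p a (u : tangent p) :
  differential F (a *: u) = a *: differential F u.
Proof. exact: val_inj. Qed.

Lemma differentialN p (u : tangent p) : differential F (- u) = - differential F u.
Proof. exact: val_inj. Qed.

Lemma verticalD p (u v : tangent p) :
  vertical F u -> vertical F v -> vertical F (u + v).
Proof. by rewrite /vertical differentialD => -> ->; rewrite addr0. Qed.

Lemma verticalZ p a (u : tangent p) : vertical F u -> vertical F (a *: u).
Proof. by rewrite /vertical differentialZ => ->; rewrite scaler0. Qed.

Lemma proj_sum p (v : tangent p) : v = PV p v + PH p v.
Proof. by have [] := projVH v. Qed.

Lemma PV_vertical p (v : tangent p) : vertical F (PV p v).
Proof. by have [] := projVH v. Qed.

Lemma PH_horizontal p (v : tangent p) : horizontal g F (PH p v).
Proof. by have [] := projVH v. Qed.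

Lemma PH_vertical p (v : tangent p) : vertical F v -> PH p v = 0.
Proof.
move=> Vv; apply: (@metric_eq0 _ _ _ g); apply: PH_horizontal.
have -> : PH p v = v + (-1) *: PV p v.
  by rewrite {2}(proj_sum v) scaleN1r addrAC subrr add0r.
by apply/verticalD/verticalZ/PV_vertical.
Qed.

Lemma PV_id p (v : tangent p) : vertical F v -> PV p v = v.
Proof. by move=> Vv; rewrite {2}(proj_sum v) (PH_vertical Vv) addr0. Qed.

Lemma PV_horizontal p (v : tangent p) : horizontal g F v -> PV p v = 0.
Proof.
move=> Hv; apply: (@metric_eq0 _ _ _ g).
have := Hv _ (PV_vertical v); rewrite {1}(proj_sum v) metricDl.
by rewrite (PH_horizontal v (PV_vertical v)) addr0.
Qed.

Lemma PH_id p (v : tangent p) : horizontal g F v -> PH p v = v.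
Proof. by move=> Hv; rewrite {2}(proj_sum v) (PV_horizontal Hv) add0r. Qed.

Lemma metric_vertical_l p (u v : tangent p) : vertical F v -> g p (PV p u) v = g p u v.
Proof.
by move=> Vv; rewrite {2}(proj_sum u) metricDl (PH_horizontal u Vv) addr0.
Qed.

Lemma metric_horizontal_l p (u v : tangent p) :
  horizontal g F v -> g p (PH p u) v = g p u v.
Proof.
move=> Hv; rewrite {2}(proj_sum u) metricDl (Defs.metric_sym g (PV p u)).
by rewrite (Hv _ (PV_vertical u)) add0r.
Qed.

Lemma metric_proj p (u v : tangent p) :
  g p u v = g p (PV p u) (PV p v) + g p (PH p u) (PH p v).
Proof.
by rewrite {1}(proj_sum v) metricDr (metric_vertical_l u (PV_vertical v))
  (metric_horizontal_l u (PH_horizontal v)).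
Qed.

Lemma differential_PH p (v : tangent p) : differential F (PH p v) = differential F v.
Proof. by rewrite {2}(proj_sum v) differentialD (PV_vertical v) add0r. Qed.

Lemma tapp_PV_vertical X : vertical_field F X -> tapp PV X = X.
Proof. by move=> VX; apply: field_at_inj => p; rewrite field_at_tapp PV_id. Qed.

Lemma tapp_PH_horizontal X : horizontal_field g F X -> tapp PH X = X.
Proof. by move=> HX; apply: field_at_inj => p; rewrite field_at_tapp PH_id. Qed.

Lemma tapp_PV_horizontal X : horizontal_field g F X -> tapp PV X = 0.
Proof.
by move=> HX; apply: field_at_inj => p; rewrite field_at_tapp PV_horizontal ?field_at0.
Qed.

Lemma tapp_PV_PH X : X = tapp PV X + tapp PH X.
Proof.
by apply: field_at_inj => p; rewrite field_atD !field_at_tapp -proj_sum.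
Qed.

Lemma PV_vertical_field X : vertical_field F (tapp PV X).
Proof. by move=> p; rewrite field_at_tapp; exact: PV_vertical. Qed.

Lemma PH_horizontal_field X : horizontal_field g F (tapp PH X).
Proof. by move=> p; rewrite field_at_tapp; exact: PH_horizontal. Qed.

Section Slant.
Variables (phi : tensor11 M) (xi : vfield M) (eta : oneform M) (theta : R).
Hypothesis contact : almost_contact_metric phi xi eta g.
Hypothesis xi_hor : horizontal_field g F xi.
Hypothesis slantF : slant g F phi PV theta.

Let metric_phi_vertical p (u v : tangent p) : vertical F u ->
  g p (phi p u) (phi p v) = g p u v.
Proof.
move=> Vu; rewrite (metric_phi_phi contact) (Defs.metric_sym g u (field_at xi p)).
by rewrite (xi_hor Vu) mul0r subr0.
Qed.

(** Vertical vectors are orthogonal to [xi], so [phi] preserves their lengths and the quotient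
    defining the angle is the length of [psi v] over that of [v]. It lies between 0 and 1, where
    [acos] can be inverted. *)
Lemma slant_cos p (v : tangent p) : vertical F v -> v != 0 ->
  [/\ 0 <= cos theta, theta = acos (cos theta) &
      g p (PV p (phi p v)) (PV p (phi p v)) = cos theta ^+ 2 * g p v v].
Proof.
move=> Vv v0; have := slantF Vv v0; rewrite /angle_ker /vnorm.
rewrite (metric_phi_vertical _ Vv); set a := g p (PV p _) _; set b := g p v v.
have b0 : 0 < b by exact: metric_pos.
have pos (w : tangent p) : 0 <= g p w w.
  by have [->|/(metric_pos g)/ltW//] := eqVneq w 0; rewrite metric0l.
have ab : a <= b.
  rewrite /b -(metric_phi_vertical v Vv) (metric_proj (phi p v)) lerDl; exact: pos.
have sb : 0 < Num.sqrt b by rewrite sqrtr_gt0.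
have r0 : 0 <= Num.sqrt a / Num.sqrt b by rewrite divr_ge0 ?sqrtr_ge0.
have r1 : Num.sqrt a / Num.sqrt b <= 1.
  by rewrite ler_pdivrMr// mul1r ler_sqrt// ltW.
have cr : cos (acos (Num.sqrt a / Num.sqrt b)) = Num.sqrt a / Num.sqrt b.
  by rewrite acosK// in_itv/= r1 andbT (le_trans _ r0)// lerN10.
move=> <-; rewrite cr; split=> //.
rewrite expr_div_n !sqr_sqrtr ?(ltW b0)//; last exact: pos.
by rewrite mulfVK// gt_eqF.
Qed.

Let psi_norm p (v : tangent p) : vertical F v ->
  g p (PV p (phi p v)) (PV p (phi p v)) = cos theta ^+ 2 * g p v v.
Proof.
have [->|v0 Vv] := eqVneq v 0; last by have [] := slant_cos Vv v0.
by rewrite !raddf0 !metric0l mulr0.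
Qed.

Let psi_inner p (u v : tangent p) : vertical F u -> vertical F v ->
  g p (PV p (phi p u)) (PV p (phi p v)) = cos theta ^+ 2 * g p u v.
Proof.
move=> Vu Vv; have := psi_norm (verticalD Vu Vv).
rewrite !raddfD !metricE /= (psi_norm Vu) (psi_norm Vv) (Defs.metric_sym g v u).
rewrite (Defs.metric_sym g (PV p (phi p v)) (PV p (phi p u))) => h; lra.
Qed.

(** On the vertical space [psi] is skew, as [phi] is, and by polarisation it scales inner products
    by [cos theta ^+ 2]; together these determine its square. *)
Lemma psi_sqr p (u : tangent p) : vertical F u ->
  PV p (phi p (PV p (phi p u))) = - cos theta ^+ 2 *: u.
Proof.
move=> Vu; set w := PV p _; have Vw : vertical F (w + cos theta ^+ 2 *: u).
  by apply: verticalD; [exact: PV_vertical|exact: verticalZ].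
suff H v : vertical F v -> g p (w + cos theta ^+ 2 *: u) v = 0.
  apply/eqP; rewrite scaleNr -addr_eq0; apply/eqP.
  exact: metric_eq0 (H _ Vw).
move=> Vv; rewrite metricDl metricZl /w metric_vertical_l//.
rewrite (metric_phi_skew contact) Defs.metric_sym.
rewrite -(metric_vertical_l _ (PV_vertical (phi p u))) psi_inner//.
by rewrite (Defs.metric_sym g v) addNr.
Qed.

Lemma psi_psi X : vertical_field F X ->
  tapp phi (psi PV phi X) =
  (- cos theta ^+ 2 *: (1 : Cinf M)) *: X + omega PH phi (psi PV phi X).
Proof.
move=> VX; rewrite {1}[tapp phi _]tapp_PV_PH; congr (_ + _).
apply: field_at_inj => p; rewrite !field_at_tapp psi_sqr// field_atZ.
by rewrite CinfZ mulr1.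
Qed.

Variable nabla : vfield M -> vfield M -> vfield M.
Hypothesis nablaLC : levi_civita g nabla.
Hypothesis nablaphi0 : forall X Y, nabla X (tapp phi Y) = tapp phi (nabla X Y).
Hypothesis nablaxi0 : forall X, nabla X xi = 0.

Lemma slant_formula E V X p : vertical_field F V -> horizontal_field g F X ->
  (1 - cos theta ^+ 2) * inner g (nabla E V) X p =
  inner g (tapp PV (nabla E (omega PH phi V))) (calB PV phi X) p
  + inner g (tapp PH (nabla E (omega PH phi V))) (calC PH phi X) p
  - inner g (tapp PH (nabla E (omega PH phi (psi PV phi V)))) X p.
Proof.
move=> VV HX; have [conn _ compat] := nablaLC.
(* [V] is orthogonal to the parallel field [xi], so its derivative is too; hence inserting [phi] in
   both slots of [g (nabla E V) X] does not change the value. *)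
have eta0 : g p (field_at (nabla E V) p) (field_at xi p) = 0.
  have Vxi : inner g V xi = 0.
    apply: Cinf_inj => q; rewrite innerE Defs.metric_sym Cinf0.
    by apply: xi_hor; exact: VV.
  have := congr1 (fun f : Cinf M => f p) (compat E V xi).
  by rewrite Vxi vfield0 CinfD nablaxi0 !innerE field_at0 metric0r addr0.
have phiV : tapp phi V = psi PV phi V + omega PH phi V by exact: tapp_PV_PH.
have e1 : inner g (nabla E V) X p =
    inner g (nabla E (psi PV phi V)) (tapp phi X) p
    + inner g (nabla E (omega PH phi V)) (tapp phi X) p.
  have := metric_phi_phi contact (field_at (nabla E V) p) (field_at X p).
  rewrite eta0 mul0r subr0 -!field_at_tapp -nablaphi0 phiV (connectionDr conn).
  by rewrite field_atD metricDl.
(* Skewness moves [phi] to the left, where it passes inside the derivative and meets [psi V]; the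
   coefficient [- cos theta ^+ 2] is constant and has no derivative. *)
have e2 : inner g (nabla E (psi PV phi V)) (tapp phi X) p =
    cos theta ^+ 2 * inner g (nabla E V) X p
    - inner g (nabla E (omega PH phi (psi PV phi V))) X p.
  have := metric_phi_skew contact (field_at (nabla E (psi PV phi V)) p) (field_at X p).
  rewrite -!field_at_tapp -nablaphi0 psi_psi// (connectionDr conn) (connectionZr conn).
  have -> : (E (- cos theta ^+ 2 *: (1 : Cinf M)) : Cinf M) = 0.
    apply: Cinf_inj => q; have := tangentZ (field_at E q) (- cos theta ^+ 2) 1.
    by rewrite tangent1 mulr0.
  rewrite scale0r add0r field_atD field_atZ metricDl metricZl CinfZ mulr1 -!innerE.
  lra.
have e3 : inner g (nabla E (omega PH phi V)) (tapp phi X) p =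
  inner g (tapp PV (nabla E (omega PH phi V))) (calB PV phi X) p
  + inner g (tapp PH (nabla E (omega PH phi V))) (calC PH phi X) p.
  by rewrite !innerE !field_at_tapp -metric_proj.
have e4 W : inner g (tapp PH W) X p = inner g W X p.
  by rewrite !innerE !field_at_tapp metric_horizontal_l.
rewrite e4 -e3; lra.
Qed.

Lemma oneill_T_vertical U V : vertical_field F U ->
  oneill_T nabla PV PH U (omega PH phi V) = tapp PV (nabla U (omega PH phi V)).
Proof.
move=> VU; have [conn _ _] := nablaLC.
have Ho : horizontal_field g F (omega PH phi V) by exact: PH_horizontal_field.
rewrite /oneill_T (tapp_PV_horizontal Ho) (connection0r conn) tapp0 add0r.
by rewrite (tapp_PV_vertical VU) (tapp_PH_horizontal Ho).
Qed.

Lemma oneill_A_horizontal Y V : horizontal_field g F Y ->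
  oneill_A nabla PV PH Y (omega PH phi V) = tapp PV (nabla Y (omega PH phi V)).
Proof.
move=> HY; have [conn _ _] := nablaLC.
have Ho : horizontal_field g F (omega PH phi V) by exact: PH_horizontal_field.
rewrite /oneill_A (tapp_PV_horizontal Ho) (connection0r conn) tapp0 addr0.
by rewrite (tapp_PH_horizontal HY) (tapp_PH_horizontal Ho).
Qed.

End Slant.
End Projections.

(** * The second fundamental form *)

Section SecondFundamentalForm.
Context {R : realType}.
Variables (m n : nat) (M : manifold R m) (N : manifold R n).
Variables (gM : metric M) (gN : metric N) (F : smooth_map M N).
Variables (nabM : vfield M -> vfield M -> vfield M).
Variables (nabN : vfield N -> vfield N -> vfield N).
Variables (nabF : vfield M -> along F -> along F).
Variables (PV PH : tensor11 M).
Hypothesis submersionF : riemannian_submersion gM gN F.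
Hypothesis nabM_LC : levi_civita gM nabM.
Hypothesis nabN_LC : levi_civita gN nabN.
Hypothesis nabF_pullback : pullback_connection nabN nabF.
Hypothesis projVH : orthogonal_projections gM F PV PH.
Implicit Types (p : M) (X Y Z : vfield M) (W : along F) (a : Cinf M).

Let connM : is_connection nabM. Proof. by have [] := nabM_LC. Qed.
Let connN : is_connection nabN. Proof. by have [] := nabN_LC. Qed.
Let connF : is_connection nabF. Proof. by have [] := nabF_pullback. Qed.

Lemma along_at_inj W W' : (forall p, along_at W p = along_at W' p) -> W = W'.
Proof.
move=> WW'; apply: derivation_inj => f; apply: Cinf_inj => p.
by have /(congr1 (fun v : tangent (F p) => v f)) := WW' p.
Qed.

Lemma along_atD W W' p : along_at (W + W') p = along_at W p + along_at W' p.
Proof. exact: val_inj. Qed.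

Lemma along_atN W p : along_at (- W) p = - along_at W p.
Proof. exact: val_inj. Qed.

Lemma along_atZ a W p : along_at (a *: W) p = a p *: along_at W p.
Proof. exact: val_inj. Qed.

Lemma along_at0 p : along_at (0 : along F) p = 0.
Proof. exact: val_inj. Qed.

Lemma along_at_sum (I : finType) (G : I -> along F) p :
  along_at (\sum_i G i) p = \sum_i along_at (G i) p.
Proof.
exact: (big_morph (fun W => along_at W p) (fun W W' => along_atD W W' p) (along_at0 p)).
Qed.

Lemma along_at_push X p : along_at (push F X) p = differential F (field_at X p).
Proof. exact: val_inj. Qed.

Lemma along_at_comp (Z : vfield N) p :
  along_at (comp_along F Z) p = field_at Z (F p).
Proof. exact: val_inj. Qed.

Lemma pushD X Y : push F (X + Y) = push F X + push F Y.
Proof. exact: val_inj. Qed.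

Lemma pushZ a X : push F (a *: X) = a *: push F X.
Proof. exact: val_inj. Qed.

Lemma push_vertical X : vertical_field F X -> push F X = 0.
Proof.
by move=> VX; apply: along_at_inj => p; rewrite along_at_push VX along_at0.
Qed.

Notation sff := (second_fundamental_form nabM nabF).

Lemma sffDr X Y Z : sff X (Y + Z) = sff X Y + sff X Z.
Proof.
rewrite /second_fundamental_form pushD (connectionDr connF) (connectionDr connM).
by rewrite pushD opprD addrACA.
Qed.

Lemma sffDl X Y Z : sff (X + Y) Z = sff X Z + sff Y Z.
Proof.
rewrite /second_fundamental_form (connectionDl connF) (connectionDl connM).
by rewrite pushD opprD addrACA.
Qed.

(** The derivative terms of the two Leibniz rules cancel. Tensoriality permits a field to be
    multiplied by a function equal to 1 at the point of interest. *)
Lemma sffZr X a Y : sff X (a *: Y) = a *: sff X Y.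
Proof.
rewrite /second_fundamental_form pushZ (connectionZr connF) (connectionZr connM).
by rewrite pushD !pushZ opprD addrACA subrr add0r scalerBr.
Qed.

Lemma sff_vertical X U : vertical_field F U -> sff X U = - push F (nabM X U).
Proof.
by move=> VU; rewrite /second_fundamental_form push_vertical// (connection0r connF) add0r.
Qed.

(** Only the horizontal part of [u] matters on either side; for two horizontal vectors it is the
    polarisation of the preservation of lengths. *)
Lemma submersion_inner p (u v : tangent p) : horizontal gM F v ->
  gN (F p) (differential F u) (differential F v) = gM p u v.
Proof.
move=> Hv; rewrite -(differential_PH projVH u) -(metric_horizontal_l projVH u Hv).
have Hu := PH_horizontal projVH u; move: (PH p u) Hu => {}u Hu.
have [_ _ iso] := submersionF.
have Huv : horizontal gM F (u + v).
  by move=> w Vw; rewrite metricDl Hu// Hv// addr0.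
have := iso p _ Huv; rewrite differentialD !metricE (iso p u Hu) (iso p v Hv).
rewrite (Defs.metric_sym gM v u).
rewrite (Defs.metric_sym gN (differential F v) (differential F u)) => h; lra.
Qed.

(** * The pullback connection in a local frame of the target *)

Section AtPoint.
Variable p : M.
Variables (chi : Cinf N) (y : 'I_n -> Cinf N) (Z : 'I_n -> vfield N).
Hypothesis chi1 : chi (F p) = 1.
Hypothesis frameE : forall q (v : tangent q) f,
  chi q * v f = chi q * \sum_i v (y i) * (Z i f : Cinf N) q.
Hypothesis frame_dual : forall i j q,
  chi q * (Z i (y j) : Cinf N) q = chi q * (i == j)%:R.

Let C := pull F chi.
Let q := F p.
Let z i := field_at (Z i) q.
Let a Y i : Cinf M := C * Y (pull F (y i)).
Let c Y i : R := (Y (pull F (y i)) : Cinf M) p.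

Let Cp : C p = 1. Proof. exact: chi1. Qed.

Let aE Y i : a Y i p = c Y i.
Proof. by rewrite /a CinfM Cp mul1r. Qed.

(* [C *: Y] agrees with [Y] at [p], while its push-forward is a combination of
   the sections [comp_along F (Z i)], on which [nabF] is prescribed. *)
Let push_frame Y : C *: push F Y = \sum_i a Y i *: comp_along F (Z i).
Proof.
apply: derivation_inj => f; apply: Cinf_inj => p'.
rewrite derivation_sum Cinf_sum derivationZ CinfM.
have /= e := frameE (along_at (push F Y) p') f; rewrite [LHS]e.
by rewrite mulr_sumr; apply: eq_bigr => i _; exact: mulrA.
Qed.

Let diff_frame Y : differential F (field_at Y p) = \sum_i c Y i *: z i.
Proof.
have := congr1 (fun W => along_at W p) (push_frame Y).
rewrite along_atZ along_at_sum Cp scale1r along_at_push => ->.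
by apply: eq_bigr => i _; rewrite along_atZ along_at_comp aE.
Qed.

(** The pullback condition prescribes [nabF] on [comp_along F Z] through a field on the target that
    equals the push-forward of [X] at the point; freezing the components of that push-forward at [p]
    provides one. *)
Let WX X : vfield N := \sum_i (c X i *: (1 : Cinf N)) *: Z i.

Let WXE X : field_at (WX X) q = differential F (field_at X p).
Proof.
rewrite diff_frame; apply: val_inj; apply/funext => f /=.
have -> : \val (\sum_i c X i *: z i) f = \sum_i (c X i *: z i) f.
  exact: (big_morph (fun v : tangent q => v f)).
rewrite derivation_sum Cinf_sum; apply: eq_bigr => i _.
by rewrite derivationZ CinfM CinfZ mulr1.
Qed.

Let nabF_frame X Y : along_at (nabF X (push F (C *: Y))) p =
  \sum_i (X (a Y i) : Cinf M) p *: z i + \sum_i c Y i *: field_at (nabN (WX X) (Z i)) q.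
Proof.
rewrite pushZ push_frame (connection_sumr connF) along_at_sum -big_split/=.
apply: eq_bigr => i _; rewrite (connectionZr connF) along_atD !along_atZ.
rewrite along_at_comp aE; congr (_ + _ *: _).
by have [_ +] := nabF_pullback; apply; rewrite WXE.
Qed.

Let christoffel i j := field_at (nabN (Z i) (Z j)) q.

Let nabN_WX X i : field_at (nabN (WX X) (Z i)) q = \sum_j c X j *: christoffel j i.
Proof.
have -> : nabN (WX X) (Z i) = \sum_j (c X j *: (1 : Cinf N)) *: nabN (Z j) (Z i).
  rewrite (big_morph (fun V => nabN V (Z i)) (fun V V' => connectionDl connN V V' _)
    (connection0l connN _)).
  by apply: eq_bigr => j _; rewrite (connectionZl connN).
rewrite (big_morph (fun V => field_at V q) (fun V V' => field_atD V V' q) (field_at0 q)).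
by apply: eq_bigr => j _; rewrite field_atZ CinfZ mulr1.
Qed.

(** The torsion is zero, so the difference is the bracket of two frame fields. Its components at [q]
    are second derivatives of the coordinates, which vanish because the first derivatives are
    constant near [q]. *)
Let christoffel_sym i j : christoffel i j = christoffel j i.
Proof.
have [_ tors _] := nabN_LC; apply/eqP; rewrite -subr_eq0 -field_atN -field_atD tors.
apply/eqP; apply: val_inj; apply/funext => f.
have := frameE (field_at (bracket (Z i) (Z j)) q) f.
rewrite chi1 !mul1r => e; rewrite [LHS]e.
(* Apply [Z k] to the global identity [chi * Z l (y r) = (l == r)%:R *: chi]: the terms with
   [Z k chi] cancel at [q]. *)
have ZZ k l r : (Z k (Z l (y r)) : Cinf N) q = 0.
  have E : chi * (Z l (y r) : Cinf N) = (l == r)%:R *: chi.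
    by apply: Cinf_inj => q'; rewrite CinfM frame_dual CinfZ mulrC.
  have := congr1 (fun f : Cinf N => (Z k f : Cinf N) q) E.
  rewrite vfieldM CinfD !CinfM chi1 mul1r.
  have -> : (Z l (y r) : Cinf N) q = (l == r)%:R.
    by have := frame_dual l r q; rewrite chi1 !mul1r.
  have /= e' := tangentZ (field_at (Z k) q) (l == r)%:R chi; rewrite e'.
  by move/(canRL (addrK _)) ->; rewrite subrr.
rewrite big1// => k _.
rewrite (_ : field_at _ _ _ =
  (Z i (Z j (y k)) : Cinf N) q - (Z j (Z i (y k)) : Cinf N) q)//.
by rewrite !ZZ subrr mul0r.
Qed.

(** In [nabF_frame] the connection part is symmetric by the symmetry of the Christoffel vectors. The
    derivative parts differ by the push-forward of [nabM X (C *: Y) - nabM Y (C *: X)], since both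
    sides apply the same commutator to the coordinates. *)
Lemma sff_frame_sym X Y : along_at (sff X Y) p = along_at (sff Y X) p.
Proof.
suff H : along_at (sff X (C *: Y)) p = along_at (sff Y (C *: X)) p.
  by move: H; rewrite !sffZr !along_atZ Cp !scale1r.
rewrite /second_fundamental_form !along_atD !along_atN !nabF_frame !along_at_push.
have S_sym : \sum_i c Y i *: field_at (nabN (WX X) (Z i)) q =
             \sum_i c X i *: field_at (nabN (WX Y) (Z i)) q.
  under eq_bigr do rewrite nabN_WX scaler_sumr.
  under [RHS]eq_bigr do rewrite nabN_WX scaler_sumr.
  rewrite exchange_big/=; apply: eq_bigr => i _; apply: eq_bigr => j _.
  by rewrite !scalerA mulrC christoffel_sym.
pose V := nabM X (C *: Y) - nabM Y (C *: X).
have VE i : c V i = (X (a Y i) : Cinf M) p - (Y (a X i) : Cinf M) p.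
  have -> : V = (X C : Cinf M) *: Y - (Y C : Cinf M) *: X + C *: bracket X Y.
    have [_ <- _] := nabM_LC; rewrite /V !(connectionZr connM) scalerBr opprD.
    by rewrite addrACA.
  rewrite /c /a !vfieldM !derivationE !CinfE Cp !mul1r.
  ring.
have AE : \sum_i (X (a Y i) : Cinf M) p *: z i - \sum_i (Y (a X i) : Cinf M) p *: z i =
    differential F (field_at (nabM X (C *: Y)) p) - differential F (field_at (nabM Y (C *: X)) p).
  rewrite -differentialN -differentialD -field_atN -field_atD diff_frame -sumrB.
  by apply: eq_bigr => i _; rewrite VE scalerBl.
rewrite S_sym -[X in X + _ - _](subrK (\sum_i (Y (a X i) : Cinf M) p *: z i)) AE.
apply/eqP; rewrite subr_eq; apply/eqP.
by rewrite -!addrA [RHS]addrA [in RHS](addrC (- _)) [RHS]addrC -addrA.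
Qed.

(** The derivative along [X] of the inner product of [C *: Y] and [C *: Y'] is computed twice: on
    [M] by metricity of [nabM], and through the frame, where horizontality turns it into pullbacks
    of the functions [inner gN (Z i) (Z j)], by metricity of [nabN]. The difference of the two
    results is the claim. *)
Lemma sff_frame_skew X Y Y' : horizontal_field gM F Y -> horizontal_field gM F Y' ->
  gN q (along_at (sff X Y) p) (differential F (field_at Y' p)) =
  - gN q (differential F (field_at Y p)) (along_at (sff X Y') p).
Proof.
move=> HY HY'.
have horZ V : horizontal_field gM F V -> horizontal_field gM F (C *: V).
  by move=> HV r u Vu; rewrite field_atZ metricZl HV ?mulr0.
have sffC V : along_at (sff X V) p = along_at (nabF X (push F (C *: V))) p
    - differential F (field_at (nabM X (C *: V)) p).
  rewrite -along_at_push -along_atN -along_atD.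
  rewrite -[RHS]/(along_at (sff X (C *: V)) p) sffZr along_atZ Cp scale1r //.
have CpE V : field_at (C *: V) p = field_at V p by rewrite field_atZ Cp scale1r.
have [_ _ compatM] := nabM_LC; have [_ _ compatN] := nabN_LC.
have eM := congr1 (fun f : Cinf M => f p) (compatM X (C *: Y) (C *: Y')).
rewrite CinfD !innerE !CpE in eM.
have isoM r (u v : tangent r) : horizontal gM F v ->
  gN (F r) (differential F u) (differential F v) = gM r u v by exact: submersion_inner.
have innerCC : inner gM (C *: Y) (C *: Y') =
    \sum_i \sum_j a Y i * a Y' j * pull F (inner gN (Z i) (Z j)).
  apply: Cinf_inj => r; rewrite innerE -isoM; last exact: horZ.
  rewrite -!along_at_push !pushZ !push_frame !along_at_sum.
  under eq_bigr do rewrite along_atZ along_at_comp.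
  under [X in gN _ _ X]eq_bigr do rewrite along_atZ along_at_comp.
  rewrite metric_sum2 !CinfE; apply: eq_bigr => i _; rewrite !CinfE.
  by apply: eq_bigr => j _; rewrite !CinfE.
have Xpull i j : (X (pull F (inner gN (Z i) (Z j))) : Cinf M) p =
    gN q (field_at (nabN (WX X) (Z i)) q) (z j) + gN q (z i) (field_at (nabN (WX X) (Z j)) q).
  have := congr1 (fun f : Cinf N => f q) (compatN (WX X) (Z i) (Z j)).
  have := congr1 (fun v : tangent q => v (inner gN (Z i) (Z j))) (WXE X).
  by move=> /= <- ->.
have key : gN q (along_at (nabF X (push F (C *: Y))) p) (differential F (field_at Y' p))
   + gN q (differential F (field_at Y p)) (along_at (nabF X (push F (C *: Y'))) p)
   = (X (inner gM (C *: Y) (C *: Y')) : Cinf M) p.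
  rewrite innerCC vfield_sum CinfE !nabF_frame !diff_frame.
  rewrite metricDl metricDr !metric_sum2 -!big_split/=; apply: eq_bigr => i _.
  rewrite -!big_split vfield_sum CinfE /=; apply: eq_bigr => j _.
  rewrite /a /c !vfieldM !CinfE Xpull Cp -[pull F _ p]/(gN q (z i) (z j)); ring.
rewrite eM -[gM p _ (field_at Y' p)]isoM// in key.
rewrite (Defs.metric_sym gM (field_at Y p)) -[gM p _ (field_at Y p)]isoM// in key.
rewrite !sffC !metricE.
rewrite (Defs.metric_sym gN (differential F (field_at Y p))
  (differential F (field_at (nabM _ _) p))).
lra.
Qed.

End AtPoint.

Lemma sff_sym X Y : sff X Y = sff Y X.
Proof.
apply: along_at_inj => p; have [chi [y [Z [chi1 fE fd]]]] := local_frame (F p).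
exact: (sff_frame_sym chi1 fE fd).
Qed.

Lemma sff_horizontal X Y : horizontal_field gM F X -> horizontal_field gM F Y ->
  sff X Y = 0.
Proof.
move=> HX HY; apply: along_at_inj => p; rewrite along_at0.
have [_ surj _] := submersionF.
(* The value of the form at [p] is the push-forward of a horizontal field [Z], so its squared length
   is the trilinear form [b X Y Z]. *)
have [v vE] := surj p (along_at (sff X Y) p).
have [Z0 Z0E] := tangent_extend v.
pose Z := tapp PH Z0.
have HZ : horizontal_field gM F Z by exact: PH_horizontal_field projVH Z0.
have ZE : differential F (field_at Z p) = along_at (sff X Y) p.
  by rewrite /Z field_at_tapp (differential_PH projVH) Z0E.
have [chi [y [W [chi1 fE fd]]]] := local_frame (F p).
pose b U V T := gN (F p) (along_at (sff U V) p) (differential F (field_at T p)).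
have b12 U V T : b U V T = b V U T by rewrite /b sff_sym.
have b23 U V T : horizontal_field gM F V -> horizontal_field gM F T ->
    b U V T = - b U T V.
  by move=> HV HT; rewrite /b (sff_frame_skew chi1 fE)// Defs.metric_sym.
(* [b] is symmetric in its first two and skew in its last two arguments. *)
apply: (@metric_eq0 _ _ _ gN); rewrite -{2}ZE -/(b X Y Z).
have := b23 X Y Z HY HZ; have := b12 X Z Y; have := b23 Z X Y HX HY.
have := b12 Z Y X; have := b23 Y Z X HZ HX; have := b12 Y X Z; lra.
Qed.

(** Splitting both arguments leaves, besides the horizontal pairs where the form vanishes, pairs
    that symmetry brings to a vertical second argument [U]; there the form is minus the push-forward
    of [nabM E U], which is zero exactly when the horizontal part is. *)
Lemma totally_geodesicP : totally_geodesic nabM nabF <->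
  (forall U V, vertical_field F U -> vertical_field F V -> tapp PH (nabM U V) = 0) /\
  (forall Y U, horizontal_field gM F Y -> vertical_field F U -> tapp PH (nabM Y U) = 0).
Proof.
have push0 X : push F X = 0 <-> tapp PH X = 0.
  split=> X0.
    apply: field_at_inj => p; rewrite field_at_tapp field_at0.
    by apply: (PH_vertical projVH); rewrite /vertical -along_at_push X0 along_at0.
  apply: along_at_inj => p.
  rewrite along_at_push along_at0 -(differential_PH projVH) -field_at_tapp X0.
  by rewrite field_at0; apply: val_inj.
have vertP E U : vertical_field F U -> sff E U = 0 <-> tapp PH (nabM E U) = 0.
  move=> VU; rewrite sff_vertical// -push0; split=> [/eqP|->]; last by rewrite oppr0.
  by rewrite oppr_eq0 => /eqP.
split=> [tg|[HU HY] X Y]; first by split=> E U _ VU; apply/vertP.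
have [VX HX] := (PV_vertical_field projVH X, PH_horizontal_field projVH X).
have [VY HY'] := (PV_vertical_field projVH Y, PH_horizontal_field projVH Y).
rewrite (tapp_PV_PH projVH X) (tapp_PV_PH projVH Y) sffDl !sffDr.
rewrite (sff_horizontal HX HY') (sff_sym (tapp PV X) (tapp PH Y)).
by rewrite !(vertP _ _ _).2 ?addr0//; [exact: HY|exact: HY|exact: HU].
Qed.

End SecondFundamentalForm.

(** * From the slant formula to the two displayed conditions *)

Theorem theorem14 (R : realType) (m n : nat) (odd_m : odd m)
    (M : manifold R m) (N : manifold R n)
    (phi : tensor11 M) (xi : vfield M) (eta : oneform M)
    (gM : metric M) (gN : metric N) (F : smooth_map M N) (theta : R)
    (nabM : vfield M -> vfield M -> vfield M)
    (nabN : vfield N -> vfield N -> vfield N)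
    (nabF : vfield M -> along F -> along F)
    (PV PH : tensor11 M)
    (cosymplectic_M : cosymplectic phi xi eta gM)
    (submersion_F : riemannian_submersion gM gN F)
    (nabM_LC : levi_civita gM nabM)
    (nabN_LC : levi_civita gN nabN)
    (nabF_pullback : pullback_connection nabN nabF)
    (PV_PH : orthogonal_projections gM F PV PH)
    (xi_horizontal : horizontal_field gM F xi)
    (slant_F : slant gM F phi PV theta)
    (theta_neq0 : theta <> 0) (theta_neq_pi2 : theta <> pi / 2) :
  totally_geodesic nabM nabF <->
  (forall U V X : vfield M,
     vertical_field F U -> vertical_field F V -> horizontal_field gM F X ->
     inner gM (tapp PH (nabM U (omega PH phi (psi PV phi V)))) X =
     inner gM (oneill_T nabM PV PH U (omega PH phi V)) (calB PV phi X) +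
     inner gM (tapp PH (nabM U (omega PH phi V))) (calC PH phi X)) /\
  (forall U X Y : vfield M,
     vertical_field F U -> horizontal_field gM F X -> horizontal_field gM F Y ->
     inner gM (tapp PH (nabM Y (omega PH phi (psi PV phi U)))) X =
     inner gM (oneill_A nabM PV PH Y (omega PH phi U)) (calB PV phi X) +
     inner gM (tapp PH (nabM Y (omega PH phi U))) (calC PH phi X)).
Proof.
have [contact normal closed_eta closed_Phi] := cosymplectic_M.
have nphi := nabla_phi0 contact normal closed_eta closed_Phi nabM_LC.
have nxi := nabla_xi contact normal closed_eta closed_Phi nabM_LC.
have formula := slant_formula PV_PH contact xi_horizontal slant_F nabM_LC nphi nxi.
(* Both conditions take this shape once the O'Neill term is rewritten as a vertical projection, so
   vertical and horizontal [E] are treated together. *)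
pose slant_eq E V X :=
  inner gM (tapp PH (nabM E (omega PH phi (psi PV phi V)))) X =
  inner gM (tapp PV (nabM E (omega PH phi V))) (calB PV phi X) +
  inner gM (tapp PH (nabM E (omega PH phi V))) (calC PH phi X).
have innerPH W X : horizontal_field gM F X -> inner gM (tapp PH W) X = inner gM W X.
  move=> HX; apply: Cinf_inj => p.
  by rewrite !innerE field_at_tapp (metric_horizontal_l PV_PH).
have eq_of E V X : vertical_field F V -> horizontal_field gM F X ->
    tapp PH (nabM E V) = 0 -> slant_eq E V X.
  move=> VV HX V0; apply: Cinf_inj => p; have := formula E V X p VV HX.
  rewrite -(innerPH (nabM E V))// V0 (innerE gM 0) field_at0 metric0l mulr0 CinfD.
  by move/eqP; rewrite eq_sym subr_eq0 => /eqP ->.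
have of_eq E V : vertical_field F V ->
    (forall X, horizontal_field gM F X -> slant_eq E V X) -> tapp PH (nabM E V) = 0.
  move=> VV eqV.
  (* Without a nonzero vertical vector, [theta] is unconstrained but [V = 0]. *)
  have [[p [v [Vv v0]]]|novert] :=
      pselect (exists p, exists v : tangent p, vertical F v /\ v != 0); last first.
    have -> : V = 0.
      apply: field_at_inj => p; rewrite field_at0; apply: contrapT => Vp.
      by apply: novert; exists p, (field_at V p); split; [exact: VV|apply/eqP].
    by have [conn _ _] := nabM_LC; rewrite (connection0r conn) tapp0.
  (* A cosine of 1 would give [theta = acos 1 = 0], and a cosine of -1 contradicts its
     nonnegativity. *)
  have c1 : 1 - cos theta ^+ 2 != 0.
    have [c0 thE _] := slant_cos PV_PH contact xi_horizontal slant_F Vv v0.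
    rewrite subr_eq0 eq_sym sqrf_eq1; apply/negP => /orP[|] /eqP cE.
      by apply: theta_neq0; rewrite thE cE acos1.
    by move: c0; rewrite cE oppr_ge0 ler10.
  (* Testing the formula against the horizontal part of [nabM E V] itself gives its squared
     length. *)
  have HX := PH_horizontal_field PV_PH (nabM E V).
  apply: (@inner_eq0 _ _ _ gM); rewrite innerPH//; apply: Cinf_inj => q.
  have := formula E V _ q VV HX; rewrite (eqV _ HX) CinfD subrr.
  by move/eqP; rewrite mulf_eq0 (negbTE c1) /= => /eqP.
rewrite (totally_geodesicP submersion_F nabM_LC nabN_LC nabF_pullback PV_PH).
split=> [[HU HY]|[HU HY]]; split.
- move=> U V X VU VV HX; rewrite (oneill_T_vertical PV_PH phi nabM_LC)//.
  by apply: eq_of => //; exact: HU.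
- move=> U X Y VU HX HY'; rewrite (oneill_A_horizontal PV_PH phi nabM_LC)//.
  by apply: eq_of => //; exact: HY.
- move=> U V VU VV; apply: of_eq => // X HX; have := HU U V X VU VV HX.
  by rewrite (oneill_T_vertical PV_PH phi nabM_LC).
- move=> Y U HY' VU; apply: of_eq => // X HX; have := HY U X Y VU HX HY'.
  by rewrite (oneill_A_horizontal PV_PH phi nabM_LC).
Qed.
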